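(* Assume that there is a constant $M\in(0,+\infty)$ such that $k(X_i,X_i)\le M^2$ almost surely for every $i\in\{1,\dots,n\}$, and that $D^\star\ge 2$. For every $y>0$ there exists an event $\Omega$ with $\mathbb{P}(\Omega)\ge 1-e^{-y}$ on which the following holds. For every $C>0$, let $$\widehat\tau\in\operatorname*{arg\,min}_{\tau\in\mathcal T_n}\Big\{\widehat{\mathcal R}_n(\tau)+\frac{C M^2 D_\tau}{n}\Big\}$$ be any minimizer, and set $$C_{\min}:=\frac{74}{3}(D^\star+1)(y+\log n+1),\qquad C_{\max}:=\frac{\underline\Delta^2}{M^2}\,\frac{\underline\Lambda_{\tau^\star}}{6D^\star}\,n .$$ If $C_{\min}<C<C_{\max}$, then $$D_{\widehat\tau}=D^\star\qquad\text{and}\qquad \frac1n\,d_\infty^{(1)}(\tau^\star,\widehat\tau)\le v_1(y):=\frac{148\,D^\star M^2}{\underline\Delta^2}\cdot\frac{y+\log n+1}{n}.$$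
   Context: Setting. Let $2\le n<+\infty$, let $\mathcal X$ be a measurable space and $X_1,\dots,X_n$ independent $\mathcal X$-valued random variables (not necessarily identically distributed). Let $k:\mathcal X\times\mathcal X\to\mathbb R$ be a measurable (symmetric) positive semidefinite kernel, $\mathcal H$ its reproducing kernel Hilbert space, assumed separable, with inner product $\langle\cdot,\cdot\rangle_{\mathcal H}$, norm $\|\cdot\|_{\mathcal H}$ and feature map $\Phi(x)=k(\cdot,x)$. Assume $\mathbb E[\sqrt{k(X_i,X_i)}]<\infty$ for all $i$ (automatic here from the boundedness assumption). Put $Y_i=\Phi(X_i)$ and let $\mu^\star_i\in\mathcal H$ be the Bochner expectation of $Y_i$. Segmentations. For integers $0=\tau_0<\tau_1<\dots<\tau_D=n$ with $1\le D\le n$, the segmentation $\tau=[\tau_0,\dots,\tau_D]$ of $\{1,\dots,n\}$ is the collection of segments $\{\tau_{\ell-1}+1,\dots,\tau_\ell\}$, $1\le\ell\le D$; $D_\tau:=D$ is its number of segments; $\mathcal T_n$ is the set of all segmentations. True segmentation. $\tau^\star\in\mathcal T_n$, with $D^\star:=D_{\tau^\star}$ segments, is the unique segmentation such that $i\mapsto\mu^\star_i$ is constant on each segment of $\tau^\star$ and takes different values on any two consecutive segments of $\tau^\star$. Empirical risk: $$\widehat{\mathcal R}_n(\tau)=\frac1n\sum_{i=1}^n k(X_i,X_i)-\frac1n\sum_{\ell=1}^{D_\tau}\Big[\frac1{\tau_\ell-\tau_{\ell-1}}\sum_{i=\tau_{\ell-1}+1}^{\tau_\ell}\ \sum_{j=\tau_{\ell-1}+1}^{\tau_\ell}k(X_i,X_j)\Big].$$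 Other notation: $\underline\Delta:=\min\{\|\mu^\star_i-\mu^\star_{i+1}\|_{\mathcal H}: 1\le i\le n-1,\ \mu^\star_i\ne\mu^\star_{i+1}\}$; $\underline\Lambda_\tau:=\frac1n\min_{1\le\ell\le D_\tau}(\tau_\ell-\tau_{\ell-1})$; for $\tau^1,\tau^2\in\mathcal T_n$ with at least two segments, $$d_\infty^{(1)}(\tau^1,\tau^2):=\max_{1\le i\le D_{\tau^1}-1}\ \min_{1\le j\le D_{\tau^2}-1}|\tau^1_i-\tau^2_j|.$$ $\log$ is the natural logarithm. *)

(* Defs.v *)
From HB Require Import structures.
From mathcomp Require Import all_boot all_order all_algebra.
From mathcomp Require Import all_classical all_reals all_analysis.
Import Order.TTheory GRing.Theory Num.Theory.
Import numFieldNormedType.Exports.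

Set Implicit Arguments.
Unset Strict Implicit.
Unset Printing Implicit Defensive.

Local Open Scope classical_set_scope.
Local Open Scope ring_scope.

Definition mutually_independent {d d' : measure_display}
    {T : measurableType d} {E : measurableType d'} {R : realType}
    (P : probability T R) (n : nat) (X : 'I_n -> {RV P >-> E}) : Prop :=
  forall (J : {set 'I_n}) (A : 'I_n -> set E),
    (forall i, measurable (A i)) ->
    P (\bigcap_(i in [set` J]) (X i @^-1` A i)) =
      (\prod_(i in J) P (X i @^-1` A i))%E.

Definition psd_kernel {E : Type} {R : realType} (k : E -> E -> R) : Prop :=
  (forall x y, k x y = k y x) /\
  (forall (m : nat) (x : 'I_m -> E) (c : 'I_m -> R),
     0 <= \sum_i \sum_j c i * c j * k (x i) (x j)).

(* The Hilbert space H, with inner product dot, is the RKHS of k: its elements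
   are identified with functions E -> R through the injective linear map ev,
   and Phi x is the element of H identified with the function k(., x). *)
Record is_rkhs {E : Type} {R : realType} (k : E -> E -> R)
    (H : completeNormedModType R) (dot : {dot H for idfun})
    (ev : H -> E -> R) (Phi : E -> H) : Prop := IsRKHS {
  rkhs_norm : forall f : H, `|f| ^+ 2 = dot f f;
  rkhs_ev_linear : forall (a : R) (f g : H) (x : E),
    ev (a *: f + g) x = a * ev f x + ev g x;
  rkhs_ev_inj : injective ev;
  rkhs_feature : forall x y : E, ev (Phi x) y = k y x;
  rkhs_reproducing : forall (f : H) (x : E), ev f x = dot f (Phi x)
}.

Definition separable (T : topologicalType) : Prop :=
  exists D : set T, countable D /\ dense D.

Definition simple_vfun {d : measure_display} {T : measurableType d}
    {R : realType} {H : completeNormedModType R} (s : T -> H) : Prop :=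
  finite_set (range s) /\ forall h : H, measurable (s @^-1` [set h]).

Definition simple_expectation {d : measure_display} {T : measurableType d}
    {R : realType} (P : probability T R) {H : completeNormedModType R}
    (s : T -> H) : H :=
  \sum_(h \in range s) fine (P (s @^-1` [set h])) *: h.

Definition is_bochner_expectation {d : measure_display} {T : measurableType d}
    {R : realType} (P : probability T R) {H : completeNormedModType R}
    (Y : T -> H) (m : H) : Prop :=
  exists s : nat -> T -> H,
    [/\ forall j, simple_vfun (s j),
        {ae P, forall w, s j w @[j --> \oo] --> Y w},
        (\int[P]_w (`|Y w - s j w|%:E))%E @[j --> \oo] --> (0 : \bar R)%E &
        simple_expectation P (s j) @[j --> \oo] --> m].

(* Equal to 0 when Y is not Bochner integrable. *)
Definition bochner_expectation {d : measure_display} {T : measurableType d}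
    {R : realType} (P : probability T R) {H : completeNormedModType R}
    (Y : T -> H) : H :=
  xget 0 [set m | is_bochner_expectation P Y m].

(* A segmentation is the sequence [:: tau_0; ...; tau_D] of its breakpoints,
   with tau_0 = 0 and tau_D = n. *)
Definition is_segmentation (n : nat) (t : seq nat) : bool :=
  [&& (1 < size t)%N, nth 0%N t 0 == 0%N, last 0%N t == n & sorted ltn t].

Record segmentation (n : nat) := Segmentation {
  breakpoints :> seq nat;
  breakpointsP : is_segmentation n breakpoints
}.

Definition nbseg (n : nat) (t : segmentation n) : nat := (size t).-1.

Definition bp (n : nat) (t : segmentation n) (l : nat) : nat := nth 0%N t l.

Definition seglen (n : nat) (t : segmentation n) (l : nat) : nat :=
  (bp t l.+1 - bp t l)%N.

(* Indices are 0-based: i : 'I_n stands for i.+1 in {1, ..., n}, and segment l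
   (with l < D) consists of the i with tau_l < i.+1 <= tau_{l+1}. *)
Definition in_seg (n : nat) (t : segmentation n) (l : nat) (i : 'I_n) : bool :=
  (bp t l <= i < bp t l.+1)%N.

Definition is_true_segmentation (n : nat) {V : Type} (mu : 'I_n -> V)
    (t : segmentation n) : Prop :=
  (forall (l : nat) (i j : 'I_n), (l < nbseg t)%N ->
     in_seg t l i -> in_seg t l j -> mu i = mu j) /\
  (forall (l : nat) (i j : 'I_n), (l.+1 < nbseg t)%N ->
     in_seg t l i -> in_seg t l.+1 j -> mu i <> mu j).

Definition empirical_risk (n : nat) {E : Type} {R : realType}
    (k : E -> E -> R) (x : 'I_n -> E) (t : segmentation n) : R :=
  n%:R^-1 * (\sum_i k (x i) (x i)) -
  n%:R^-1 * (\sum_(0 <= l < nbseg t)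
     (seglen t l)%:R^-1 *
     (\sum_(i | in_seg t l i) \sum_(j | in_seg t l j) k (x i) (x j))).

Definition penalized_risk (n : nat) {E : Type} {R : realType}
    (k : E -> E -> R) (x : 'I_n -> E) (M C : R) (t : segmentation n) : R :=
  empirical_risk k x t + C * M ^+ 2 * (nbseg t)%:R / n%:R.

(* A minimum whenever mu is not constant, the set being then finite and
   nonempty. *)
Definition min_jump (n : nat) {R : realType} {H : completeNormedModType R}
    (mu : 'I_n -> H) : R :=
  inf [set r : R | exists i j : 'I_n,
    [/\ val j = (val i).+1, mu i <> mu j & r = `|mu i - mu j|] ].

(* The default value n of the minimum is neutral: segment lengths are at
   most n. *)
Definition min_rel_seglen (n : nat) {R : realType} (t : segmentation n) : R :=
  (\big[minn/n]_(0 <= l < nbseg t) seglen t l)%:R / n%:R.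

(* The default value n of the inner minimum is neutral as soon as t2 has at
   least two segments: distances between breakpoints are at most n. *)
Definition d_infty1 (n : nat) (t1 t2 : segmentation n) : nat :=
  \max_(1 <= i < nbseg t1) \big[minn/n]_(1 <= j < nbseg t2)
    `|(bp t1 i)%:Z - (bp t2 j)%:Z|%N.

(* Main.v *)
Require Import Defs.
From HB Require Import structures.
From mathcomp Require Import all_boot all_order all_algebra finmap.
From mathcomp Require Import all_classical all_reals all_analysis.
From mathcomp Require Import measurable_realfun.
From mathcomp Require Import zify ring lra.

(** Write Y_i = Phi (X_i) = mu_i + e_i, x = y + ln n + 1 and B = 8 M^2 x, and
    let F_t be the space of families in H^n that are constant on the segments
    of t. The empirical risk of t is |Y - Pi_t Y|^2 / n, where Pi_t is the
    orthogonal projection onto F_t, that is, the mean over each segment.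

    Randomness enters through a single event: for each of the at most n^2
    intervals I of indices, |sum_(i in I) e_i|^2 <= B #|I|
    ([uniform_noise_bound]). Controlling intervals rather than segmentations
    keeps the union bound polynomial. The tail of one interval comes from
    the exponential moment of |S|^2. Adding one independent centred term e
    changes E exp (a |S|^2) into at most
    exp (4 a M^2) E exp (a (1 + 2 a M^2) |S|^2), because <S, e> varies in an
    interval of length 2 M |S| and Hoeffding's bound applies to it
    ([exp_moment_add_noise]). Iterating over N terms gives
    E exp (a |S|^2) <= (1 - 2 a M^2 N)^-2 ([exp_moment_noise_sum]), hence
    P (|S|^2 >= N B) <= 4 exp (- 2 x). This needs mu_i to be the Bochner mean
    of Y_i; that it exists follows from the separability of the Hilbert space
    ([bochner_expectation_exists]).

    On that event everything is Euclidean geometry. Let t be a minimizer with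
    D' segments, tstar the true segmentation with D segments,
    A = |mu - Pi_t mu|^2, and s the common refinement of t and tstar, which has
    at most D + D' - 1 segments, so that |Pi_s e|^2 <= (D + D' - 1) B. Comparing
    the penalized risks of t and tstar gives, for each 0 < th <= 1,
      (1 - th) A + C M^2 (D' - D) <= (D + D' - 1) B / th
    ([block_mean_gap], [detection_gap]). Moreover, a true change point that is
    at distance at least dl from all breakpoints of t, with dl at most the
    length L of the shortest true segment, forces A >= dl Delta^2 / 2, where
    Delta is the smallest jump ([missed_breakpoint_residual]). Three choices
    of th conclude.
    - th = 1 discards A, and the lower bound on C excludes D' > D.
    - th = 1/4: if D' < D then, by pigeonhole, some true change point is at
      distance at least L / 2 from t, so that A >= L Delta^2 / 4, which
      contradicts the two bounds on C.
    - th = 1/2: if D' = D then A <= 64 D M^2 x, so that dl is at most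
      128 D M^2 x / Delta^2, which the two bounds on C make smaller than L. *)

Set Implicit Arguments.
Unset Strict Implicit.
Unset Printing Implicit Defensive.

Import Order.TTheory GRing.Theory Num.Theory.
Import numFieldNormedType.Exports.

Local Open Scope classical_set_scope.
Local Open Scope ring_scope.

(** * Exponential inequalities *)

Section ExponentialInequalities.
Context {R : realType}.
Implicit Types (p q t m : R).

Lemma two_point_mean_gt0 p q t : 0 <= p -> 0 <= q -> p + q = 1 ->
  0 < p * expR t + q * expR (- t).
Proof.
move=> p0 q0 pq; have [p_gt0|p_le0] := ltP 0 p.
  by rewrite ltr_pwDl ?mulr_gt0 ?mulr_ge0 ?expR_gt0 ?expR_ge0.
have -> : p = 0 by apply/le_anti; rewrite p_le0 p0.
have -> : q = 1 by lra.
by rewrite mul0r add0r mul1r expR_gt0.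
Qed.

(** The left-hand side divided by the factor p e^t + q e^-t is the mean of the
    tilted law, whose derivative in t is a variance on {-1, 1}, at most 1. *)
Lemma two_point_tilted_mean_le p q t : 0 <= p -> 0 <= q -> p + q = 1 -> 0 <= t ->
  p * expR t - q * expR (- t) <=
  (t + (p - q)) * (p * expR t + q * expR (- t)).
Proof.
move=> p0 q0 pq t0.
pose D u : R := p * expR u + q * expR (- u).
pose N u : R := p * expR u - q * expR (- u).
have D0 u : 0 < D u by exact: two_point_mean_gt0.
pose F u : R := u - N u / D u.
have dD (u : R) : is_derive u 1 D (N u).
  apply: is_derive_eq; rewrite /N ?scaler1 /GRing.scale /=. ring.
have dN (u : R) : is_derive u 1 N (D u).
  by apply: is_derive_eq; rewrite /D ?scaler1 /GRing.scale /=; ring.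
have dF (u : R) : is_derive u 1 F (N u ^+ 2 / D u ^+ 2).
    have Du : D u != 0 by rewrite gt_eqF.
  have dV : is_derive u 1 (fun x => (D x)^-1) (- (D u) ^- 2 *: N u).
    exact: is_deriveV.
  have := is_deriveB (is_derive_id u 1) (is_deriveM (dN u) dV).
  move=> h; apply: (@is_derive_eq _ _ _ _ _ _ _ _ h); rewrite /GRing.scale /=.
  by field.
have : F 0 <= F t.
  apply: (@ger0_derive1_ndecr _ F 0 t) => // [x _|].
  - by rewrite derive1E; have [_ ->] := dF x; rewrite divr_ge0 ?sqr_ge0.
  - apply: continuous_subspaceT => x; apply: differentiable_continuous.
    by apply/derivable1_diffP; have [] := dF x.
rewrite /F /N /D oppr0 expR0 !mulr1 pq divr1 -/(N t) -/(D t) => hF.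
have : N t / D t <= t + (p - q) by lra.
by rewrite ler_pdivrMr.
Qed.

(** The ratio of the two sides decreases on t >= 0 because the logarithmic
    derivative of the left-hand side is the tilted mean bounded above. *)
Lemma two_point_subgaussian_nonneg p q t :
  0 <= p -> 0 <= q -> p + q = 1 -> 0 <= t ->
  p * expR t + q * expR (- t) <= expR (t * (p - q) + t ^+ 2 / 2).
Proof.
move=> p0 q0 pq t0; set m := p - q.
pose G u : R := expR (- (u * m + u ^+ 2 / 2)) * (p * expR u + q * expR (- u)).
have dG (u : R) : is_derive u 1 G (expR (- (u * m + u ^+ 2 / 2)) *
   ((p * expR u - q * expR (- u)) - (u + m) * (p * expR u + q * expR (- u)))).
  apply: is_derive_eq; rewrite ?scaler1 /GRing.scale /=. 
  by field.
have : G t <= G 0.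
  rewrite -lerN2; apply: (@ger0_derive1_ndecr _ (- G) 0 t) => // [x|].
  - rewrite in_itv/= => /andP[x0 _].
    rewrite derive1E deriveN; last by have [] := dG x.
    have [_ ->] := dG x.
    rewrite -mulrN mulr_ge0 ?expR_ge0// opprB subr_ge0.
    exact: two_point_tilted_mean_le (ltW x0).
  - apply: continuous_subspaceT => x; apply: differentiable_continuous.
    by apply/derivable1_diffP; apply: derivableN; have [] := dG x.
rewrite /G expr0n /= !mul0r addr0 !oppr0 expR0 !mulr1 mul1r pq.
by rewrite expRN mulrC ler_pdivrMr ?expR_gt0// mul1r.
Qed.

(** Exchanging the two atoms changes t into - t. *)
Lemma two_point_subgaussian p q t : 0 <= p -> 0 <= q -> p + q = 1 ->
  p * expR t + q * expR (- t) <= expR (t * (p - q) + t ^+ 2 / 2).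
Proof.
move=> p0 q0 pq; have [t0|/ltW t0] := leP 0 t.
  exact: two_point_subgaussian_nonneg.
have := @two_point_subgaussian_nonneg q p (- t) q0 p0.
rewrite oppr_ge0 opprK sqrrN mulNr -mulrN opprB [q * _ + _]addrC.
by apply; rewrite // addrC.
Qed.

Lemma expR_chord (b t : R) : 0 < b -> `|t| <= b ->
  expR t <= ((1 + t / b) / 2) * expR b + ((1 - t / b) / 2) * expR (- b).
Proof.
move=> b0; rewrite ler_norml => /andP[bt tb].
pose s := (1 + t / b) / 2.
have tb1 : -1 <= t / b <= 1 by rewrite ler_pdivlMr// ler_pdivrMr// mulN1r mul1r bt.
have s01 : 0 <= s <= 1 by rewrite /s; apply/andP; split; lra.
have /andP[s0 s1] := s01.
have := convex_expR (Itv01 s0 s1) b (- b).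
rewrite !convRE /= -[unstable.onem s]/(1 - s).
have -> : s * b + (1 - s) * (- b) = t by rewrite /s; field; rewrite gt_eqF.
by have -> : 1 - s = (1 - t / b) / 2 by rewrite /s; field; rewrite gt_eqF.
Qed.

End ExponentialInequalities.

(** * Hoeffding's bound *)

Section BoundedVariables.
Context {d : measure_display} {T : measurableType d} {R : realType}.
Variable P : probability T R.
Implicit Types (W : T -> R) (b m : R).

Lemma ae_bounded_le_integral W b : measurable_fun setT W -> 0 <= b ->
  {ae P, forall w, `|W w| <= b} -> (\int[P]_w `|(W w)%:E| <= b%:E)%E.
Proof.
move=> mW b0 Wb; apply: (@le_trans _ _ (\int[P]_w (cst b%:E w)))%E.
  apply: ae_ge0_le_integral => //.
  - by apply/measurable_EFinP; exact: measurableT_comp.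
  - by move: Wb; apply: filterS => w Ww _ /=; rewrite lee_fin.
by rewrite integral_cst// [X in (_ * X)%E]probability_setT mule1.
Qed.

Lemma ae_bounded_integrable W b : measurable_fun setT W -> 0 <= b ->
  {ae P, forall w, `|W w| <= b} -> P.-integrable setT (EFin \o W).
Proof.
move=> mW b0 Wb; apply/integrableP; split; first exact/measurable_EFinP.
by apply: le_lt_trans (ae_bounded_le_integral mW b0 Wb) _; rewrite ltry.
Qed.

(** Exponential convexity reduces the law of a variable with values in
    [-b, b] to the law on {-b, b} with the same mean. *)
Lemma hoeffding_mgf W b m : measurable_fun setT W -> 0 <= b ->
  {ae P, forall w, `|W w| <= b} -> (\int[P]_w (W w)%:E = m%:E)%E ->
  (\int[P]_w (expR (W w))%:E <= (expR (m + b ^+ 2 / 2))%:E)%E.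
Proof.
move=> mW b0 Wb Wm.
have iW := ae_bounded_integrable mW b0 Wb.
have mb : `|m| <= b.
  rewrite -lee_fin -abse_EFin -Wm.
  apply: (le_trans _ (ae_bounded_le_integral mW b0 Wb)).
  by apply: le_abse_integral => //; exact/measurable_EFinP.
have sb0 : expR b - expR (- b) >= 0 by rewrite subr_ge0 ler_expR; lra.
pose al := (expR b - expR (- b)) / (2 * b).
pose be := (expR b + expR (- b)) / 2.
have chordE t : ((1 + t / b) / 2) * expR b + ((1 - t / b) / 2) * expR (- b) =
    al * t + be.
  rewrite /al /be invfM; ring.
have ial : P.-integrable setT (fun w => (al%:E * (W w)%:E)%E).
  exact: integrableZl iW.
have ibe : P.-integrable setT (cst be%:E) by apply: finite_measure_integrable_cst.
have chordP t : `|t| <= b -> expR t <= al * t + be.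
  move=> tb; rewrite -chordE; have [b_gt0|b_le0] := ltP 0 b.
    exact: expR_chord.
  have b_eq0 : b = 0 by apply/le_anti; rewrite b0 b_le0.
  move: tb; rewrite b_eq0 normr_le0 => /eqP->.
  by rewrite oppr0 expR0 mul0r; lra.
have mal : measurable_fun setT (fun w => al * W w + be).
  by apply: measurable_funD => //; apply: measurable_funM.
apply: (@le_trans _ _ (\int[P]_w (`|al * W w + be|)%:E))%E.
  apply: ae_ge0_le_integral => //.
  - by apply/measurable_EFinP; apply: measurableT_comp.
  - by apply/measurable_EFinP; apply: measurableT_comp.
  - move: Wb; apply: filterS => w Ww _ /=; rewrite lee_fin.
    by apply: le_trans (chordP _ Ww) _; exact: ler_norm.
have -> : (\int[P]_w (`|al * W w + be|)%:E = \int[P]_w (al * W w + be)%:E)%E.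
  apply: ae_eq_integral => //.
  - by apply/measurable_EFinP; apply: measurableT_comp.
  - exact/measurable_EFinP.
  - move: Wb; apply: filterS => w Ww _; rewrite ger0_norm//.
    by apply: le_trans (chordP _ Ww); exact: expR_ge0.
rewrite (_ : (\int[P]_w _ = (al * m + be)%:E)%E); last first.
  transitivity (\int[P]_w ((al%:E * (W w)%:E) + cst be%:E w))%E => //.
  rewrite integralD// (@integralZl _ _ _ P _ measurableT (EFin \o W) iW) Wm.
  rewrite integral_cst// [X in (_ + _ * X)%E]probability_setT mule1.
  by rewrite -EFinM -EFinD.
rewrite lee_fin -chordE; have [b_gt0|b_le0] := ltP 0 b; last first.
  have b_eq0 : b = 0 by apply/le_anti; rewrite b0 b_le0.
  move: mb; rewrite b_eq0 normr_le0 => /eqP->.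
  by rewrite oppr0 expr0n /= mul0r mul0r !addr0 subr0 expR0; lra.
have mb1 : -1 <= m / b <= 1.
  by rewrite ler_pdivlMr// ler_pdivrMr// mulN1r mul1r -ler_norml.
have := @two_point_subgaussian _ ((1 + m / b) / 2) ((1 - m / b) / 2) b.
rewrite (_ : b * _ = m); last by field; rewrite gt_eqF.
by apply; lra.
Qed.

End BoundedVariables.

(** * Inner products *)

Section InnerProduct.
Context {R : realType} {H : lmodType R}.
Variable dot : {dot H for idfun}.
Implicit Types (u v w : H) (a : R).

Lemma dotC u v : dot u v = dot v u.
Proof. by rewrite (hermC dot u v) expr0 mul1r. Qed.

Lemma dotDl u v w : dot (u + v) w = dot u w + dot v w.
Proof. exact: linearDl. Qed.

Lemma dotBl u v w : dot (u - v) w = dot u w - dot v w.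
Proof. exact: linearBl. Qed.

Lemma dotZl a u w : dot (a *: u) w = a * dot u w.
Proof. exact: linearZl_LR. Qed.

Lemma dot0l w : dot 0 w = 0.
Proof. exact: linear0l. Qed.

Lemma dot_suml (I : Type) (r : seq I) (Q : pred I) (F : I -> H) w :
  dot (\sum_(i <- r | Q i) F i) w = \sum_(i <- r | Q i) dot (F i) w.
Proof. exact: linear_sumlz. Qed.

Lemma dotDr u v w : dot w (u + v) = dot w u + dot w v.
Proof. by rewrite ![dot w _]dotC dotDl. Qed.

Lemma dotBr u v w : dot w (u - v) = dot w u - dot w v.
Proof. by rewrite ![dot w _]dotC dotBl. Qed.

Lemma dotZr a u w : dot w (a *: u) = a * dot w u.
Proof. by rewrite ![dot w _]dotC dotZl. Qed.

Lemma dot0r w : dot w 0 = 0.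
Proof. by rewrite dotC dot0l. Qed.

Lemma dot_sumr (I : Type) (r : seq I) (Q : pred I) (F : I -> H) w :
  dot w (\sum_(i <- r | Q i) F i) = \sum_(i <- r | Q i) dot w (F i).
Proof. by rewrite dotC dot_suml; apply: eq_bigr => i _; rewrite dotC. Qed.

Lemma dotvv_ge0 u : 0 <= dot u u.
Proof.
have [->|u0] := eqVneq u 0; first by rewrite dot0l.
exact/ltW/neq0_dnorm_gt0.
Qed.

Lemma dot_sqrD u v : dot (u + v) (u + v) = dot u u + 2 * dot u v + dot v v.
Proof. by rewrite !dotDl !dotDr (dotC v u); ring. Qed.

Lemma dot_sqrB u v : dot (u - v) (u - v) = dot u u - 2 * dot u v + dot v v.
Proof. by rewrite !dotBl !dotBr (dotC v u); ring. Qed.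

Lemma dot_cauchy_schwarz u v : dot u v ^+ 2 <= dot u u * dot v v.
Proof.
have [->|v0] := eqVneq v 0; first by rewrite !dot0r expr0n /= mulr0.
have vv : 0 < dot v v by exact: neq0_dnorm_gt0.
have := dotvv_ge0 (dot v v *: u - dot u v *: v).
rewrite dot_sqrB !dotZl !dotZr.
rewrite [X in 0 <= X](_ : _ = dot v v * (dot u u * dot v v - dot u v ^+ 2)).
  by rewrite pmulr_rge0// subr_ge0.
by ring.
Qed.

(** The parallelogram inequality, in the form that bounds from below the
    distance of two values to a common point. *)
Lemma dot_le_parallelogram u v w :
  dot (u - v) (u - v) <= 2 * (dot (u - w) (u - w) + dot (v - w) (v - w)).
Proof.
have -> : u - v = (u - w) - (v - w) by rewrite opprB addrA subrK.
move: (u - w) (v - w) => a b; have := dotvv_ge0 (a + b).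
by rewrite dot_sqrD dot_sqrB; lra.
Qed.

End InnerProduct.

(** * Bochner expectations and mean embeddings *)

Section HilbertNorm.
Context {R : realType} {H : completeNormedModType R}.
Variable dot : {dot H for idfun}.
Hypothesis normE : forall f : H, `|f| ^+ 2 = dot f f.
Implicit Types (u v w : H).

Lemma norm_cauchy_schwarz u v : `|dot u v| <= `|u| * `|v|.
Proof.
rewrite -(@ler_pXn2r _ 2)// ?nnegrE ?mulr_ge0// real_normK ?num_real//.
by rewrite exprMn !normE dot_cauchy_schwarz.
Qed.

Lemma cvg_dotl (u : nat -> H) (l v : H) :
  u j @[j --> \oo] --> l -> dot (u j) v @[j --> \oo] --> dot l v.
Proof.
move=> ul; apply/cvgrPdist_le => e e0.
have e1 : 0 < e / (`|v| + 1) by rewrite divr_gt0// ltr_wpDl.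
move/cvgrPdist_le : ul => /(_ _ e1); apply: filterS => j uj.
rewrite -dotBl (le_trans (norm_cauchy_schwarz _ _))//.
rewrite (le_trans (ler_wpM2r (normr_ge0 v) uj))//.
by rewrite mulrAC ler_pdivrMr ?ltr_wpDl// ler_pM2l// lerDl.
Qed.

End HilbertNorm.

Section IntegralMonotone.
Context {d : measure_display} {T : measurableType d} {R : realType}.
Variable mu : {measure set T -> \bar R}.

(** The integral of a nonnegative function is a supremum over the simple
    functions below it, hence is monotone without any measurability. The norm
    of Y - s_j in the definition of the Bochner expectation is only known to
    be measurable for special approximations s_j. *)
Lemma ge0_le_integral_nonmeasurable (f g : T -> \bar R) :
  (forall w, 0 <= f w)%E -> (forall w, f w <= g w)%E ->
  (\int[mu]_w f w <= \int[mu]_w g w)%E.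
Proof.
move=> f0 fg; have g0 w : (0 <= g w)%E by apply: le_trans (fg w).
rewrite !ge0_integralTE//; apply: le_ereal_sup => _ [h hf <-].
by exists h => // w; apply: le_trans (fg w).
Qed.

End IntegralMonotone.

Section BochnerExpectation.
Context {d : measure_display} {T : measurableType d} {R : realType}.
Variable P : probability T R.
Context {H : completeNormedModType R}.
Variable dot : {dot H for idfun}.
Hypothesis normE : forall f : H, `|f| ^+ 2 = dot f f.
Implicit Types (s Y : T -> H) (m v : H).

Lemma simple_vfun_dotE s v : simple_vfun s ->
  (fun w => dot (s w) v) =
  (fun w => \sum_(h <- fset_set (range s)) dot h v * \1_(s @^-1` [set h]) w).
Proof.
move=> [fs _]; apply/funext => w.
have sw : s w \in fset_set (range s) by rewrite in_fset_set// inE; exists w.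
rewrite (big_fsetD1 (s w))//= indicE mem_set// mulr1 big1_seq ?addr0// => h.
rewrite in_fsetD1 => /andP[_ /andP[hsw _]].
rewrite indicE memNset ?mulr0// => /= swh.
by rewrite swh eqxx in hsw.
Qed.

Lemma simple_vfun_dot_measurable s v : simple_vfun s ->
  measurable_fun setT (fun w => dot (s w) v).
Proof.
move=> ss; rewrite (simple_vfun_dotE v ss); apply: measurable_sum => h.
by apply: measurable_funM => //; apply: measurable_indic; have [_] := ss.
Qed.

Lemma simple_vfun_dot_integrable s v : simple_vfun s ->
  P.-integrable setT (fun w => (dot (s w) v)%:E).
Proof.
move=> ss; have [fs ms] := ss.
rewrite (_ : (fun w => _) = fun w => (\sum_(h <- fset_set (range s))
    (dot h v)%:E * (\1_(s @^-1` [set h]) w)%:E)%E); last first.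
  apply/funext => w; have /(congr1 (fun f => f w)) /= -> := simple_vfun_dotE v ss.
  by rewrite -sumEFin; apply: eq_bigr => h _; rewrite EFinM.
apply: integrable_sum => // h _; apply: integrableZl => //.
exact: integrable_indic.
Qed.

(** Inner products turn vector-valued expectations into real integrals. *)
Lemma simple_expectation_dot s v : simple_vfun s ->
  (\int[P]_w (dot (s w) v)%:E = (dot (simple_expectation P s) v)%:E)%E.
Proof.
move=> ss; have [fs ms] := ss.
transitivity (\int[P]_w (\sum_(h <- fset_set (range s))
    (dot h v)%:E * (\1_(s @^-1` [set h]) w)%:E))%E.
  apply: eq_integral => w _.
  have /(congr1 (fun f => f w)) /= -> := simple_vfun_dotE v ss.
  by rewrite -sumEFin; apply: eq_bigr => h _; rewrite EFinM.
have iind h : P.-integrable setT (fun w => (\1_(s @^-1` [set h]) w)%:E).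
  exact: integrable_indic.
rewrite integral_sum//; last by move=> h; exact: integrableZl.
rewrite /simple_expectation fsbig_finite//= dot_suml -sumEFin.
apply: eq_bigr => h _; rewrite integralZl// dotZl integral_indic// setIT.
by rewrite muleC EFinM fineK// fin_num_measure.
Qed.

(** The norm of v is at most 1 so that the error is dominated by
    w |-> `|Y w - s j w|, which need not be measurable. *)
Lemma bochner_dot_unit Y m v : is_bochner_expectation P Y m -> `|v| <= 1 ->
  measurable_fun setT (fun w => dot (Y w) v) ->
  P.-integrable setT (fun w => (dot (Y w) v)%:E) ->
  (\int[P]_w (dot (Y w) v)%:E = (dot m v)%:E)%E.
Proof.
move=> [s [ss _ sY sm]] v1 mY iY.
have h1 : (\int[P]_w (dot (s j w) v)%:E)%E @[j --> \oo] --> (dot m v)%:E.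
  under eq_fun do rewrite simple_expectation_dot//.
  by apply: cvg_EFin; [exact: nearW|exact: cvg_dotl sm].
have h2 : (\int[P]_w (dot (s j w) v)%:E)%E @[j --> \oo] -->
    (\int[P]_w (dot (Y w) v)%:E)%E.
  apply/sube_cvg0; first exact: integrable_fin_num.
  apply/cvg_abse0P.
  apply: (squeeze_cvge _ (cvg_cst 0%E) sY); apply: nearW => j.
  rewrite abse_ge0/= -integralB//; last exact: simple_vfun_dot_integrable.
  apply: le_trans (le_abse_integral _ _ _) _ => //.
    apply: emeasurable_funB; apply/measurable_EFinP => //.
    exact: simple_vfun_dot_measurable.
  apply: ge0_le_integral_nonmeasurable => [w|w]; first exact: abse_ge0.
  rewrite -EFinB/= lee_fin -dotBl distrC (le_trans (norm_cauchy_schwarz normE _ _))//.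
  by rewrite -normrN opprB ler_piMr.
exact: cvg_unique h2 h1.
Qed.

(** Rescaling v removes the bound on its norm. *)
Lemma bochner_dot Y m v : is_bochner_expectation P Y m ->
  measurable_fun setT (fun w => dot (Y w) v) ->
  P.-integrable setT (fun w => (dot (Y w) v)%:E) ->
  (\int[P]_w (dot (Y w) v)%:E = (dot m v)%:E)%E.
Proof.
move=> Ym mY iY; set c := `|v| + 1.
have c0 : 0 < c by rewrite ltr_wpDl.
pose u := c^-1 *: v.
have cu : v = c *: u by rewrite scalerA divff ?scale1r// gt_eqF.
have Yu w : dot (Y w) u = c^-1 * dot (Y w) v by rewrite dotZr.
have iu : P.-integrable setT (fun w => (dot (Y w) u)%:E).
  under eq_fun do rewrite Yu EFinM.
  exact: integrableZl.
transitivity (\int[P]_w (c%:E * (dot (Y w) u)%:E))%E.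
  by apply: eq_integral => w _; rewrite {1}cu dotZr EFinM.
rewrite integralZl// (@bochner_dot_unit Y m u)//.
- by rewrite -EFinM -dotZr -cu.
- rewrite normrZ gtr0_norm ?invr_gt0// mulrC ler_pdivrMr// mul1r.
  by rewrite lerDl.
- by under eq_fun do rewrite Yu; apply: measurable_funM.
Qed.

End BochnerExpectation.

Section DenseSequence.

Lemma countable_enum {T : pointedType} (D : set T) : countable D ->
  exists f : nat -> T, D `<=` range f.
Proof.
move=> /countable_injP[g injg].
exists (fun n => xget point [set x | D x /\ g x = n]) => x Dx.
exists (g x) => //; case: xgetP => [z _ [Dz gz]|/(_ x)[]//].
by apply: injg => //; rewrite inE.
Qed.

(** A subset of a separable space is separable. The points are taken in E, not
    in H: distances between feature vectors are expressions in the kernel, so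
    that nearest-point approximations along y are measurable. *)
Lemma separable_image_dense {R : realType} {H : completeNormedModType R}
  {E : choiceType} (Phi : E -> H) (x0 : E) : separable H ->
  exists y : nat -> E, forall x e, 0 < e -> exists l, `|Phi x - Phi (y l)| < e.
Proof.
move=> [D [cD dD]]; have [f Df] := countable_enum cD.
(* For each point f i of the dense sequence and each precision 1 / (q + 1), a
   point of E whose image is that close to f i, if there is one. *)
pose near_f (p : nat * nat) (z : E) := `|Phi z - f p.1| < p.2.+1%:R^-1.
pose pick_near p : E := xget x0 [set z | near_f p z].
exists (fun l => pick_near (odflt (0, 0)%N (choice.unpickle l))) => x e e0.
have [q qe] : exists q : nat, q.+1%:R^-1 < e / 2 :> R.
  have e2 : 0 < e / 2 by rewrite divr_gt0.
  have /cvgrPdist_lt /(_ _ e2) [N _ hN] := @cvg_harmonic R.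
  exists N; have := hN N (leqnn N).
  by rewrite /= sub0r normrN ger0_norm// invr_ge0.
have [h [hball /Df[i _ fih]]] : (ball (Phi x) (q.+1%:R^-1 : R) `&` D) !=set0.
  apply: dD; last exact: ball_open.
  by exists (Phi x); apply: ballxx; rewrite invr_gt0.
exists (choice.pickle (i, q)); rewrite choice.pickleK /=.
have near_x : near_f (i, q) x by move: hball; rewrite -ball_normE /near_f /= fih.
have near_pick : near_f (i, q) (pick_near (i, q)).
  by rewrite /pick_near; case: xgetP => [z _ //|/(_ x)].
rewrite -(subrKA (f i)) (splitr e).
rewrite (le_lt_trans (ler_normD _ _))// ltrD// ?(lt_trans _ qe)//.
by rewrite distrC.
Qed.

End DenseSequence.

Section MeasurableChoice.
Context {d : measure_display} {E : measurableType d} {R : realType}.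

Lemma measurable_fun_nat_index (f : nat -> E -> R) (J : E -> nat) :
  (forall l, measurable_fun setT (f l)) -> measurable_fun setT J ->
  measurable_fun setT (fun x => f (J x) x).
Proof.
move=> mf mJ _ B mB.
rewrite setTI (_ : _ @^-1` B = \bigcup_l ((J @^-1` [set l]) `&` (f l @^-1` B))).
  apply: bigcup_measurable => l _; apply: measurableI.
    by rewrite -[_ @^-1` _]setTI; apply: mJ.
  by rewrite -[_ @^-1` _]setTI; apply: mf.
apply/seteqP; split => [x /= Bx|x [l _ [/= <-]]] //.
by exists (J x).
Qed.

(** Defined by recursion so that measurability in x follows by induction. *)
Fixpoint running_argmin (f : nat -> E -> R) (j : nat) (x : E) : nat :=
  if j is i.+1 then
    if f i.+1 x < f (running_argmin f i x) x then i.+1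
    else running_argmin f i x
  else 0%N.

Lemma running_argmin_measurable f j :
  (forall l, measurable_fun setT (f l)) ->
  measurable_fun setT (running_argmin f j).
Proof.
move=> mf; elim: j => [|j IH] /=; first exact: measurable_cst.
apply: measurable_fun_ifT => //; apply: measurable_fun_ltr => //.
exact: measurable_fun_nat_index.
Qed.

Lemma running_argmin_le f j x : (running_argmin f j x <= j)%N.
Proof. by elim: j => //= j IH; case: ifP => // _; exact: leqW. Qed.

Lemma running_argmin_min f j l x : (l <= j)%N ->
  f (running_argmin f j x) x <= f l x.
Proof.
elim: j l => [|j IH] l /=; first by rewrite leqn0 => /eqP->.
rewrite leq_eqVlt ltnS => /predU1P[->|lj]; first by case: ltP.
case: ltP => [lt|_]; last exact: IH.
by apply: le_trans (IH _ lj); exact: ltW.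
Qed.

End MeasurableChoice.

Lemma dot_feature {R : realType} {E : Type} (k : E -> E -> R)
    {H : completeNormedModType R} (dot : {dot H for idfun})
    (ev : H -> E -> R) (Phi : E -> H) :
  psd_kernel k -> is_rkhs k dot ev Phi ->
  forall x y, dot (Phi x) (Phi y) = k x y.
Proof.
move=> hk hH x y.
by rewrite -(rkhs_reproducing hH) (rkhs_feature hH) (proj1 hk).
Qed.

Section MeanEmbedding.
Context {d : measure_display} {T : measurableType d} {R : realType}.
Variable P : probability T R.
Context {d' : measure_display} {E : measurableType d'}.
Variables (k : E -> E -> R) (hk : psd_kernel k).
Hypothesis hkm : measurable_fun [set: E * E] (fun p : E * E => k p.1 p.2).
Context {H : completeNormedModType R}.
Variables (dot : {dot H for idfun}) (ev : H -> E -> R) (Phi : E -> H).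
Hypotheses (hH : is_rkhs k dot ev Phi) (hsep : separable H).

Let normE : forall f : H, `|f| ^+ 2 = dot f f := rkhs_norm hH.

Lemma measurable_kernel_comp {d1} {A : measurableType d1} (f g : A -> E) :
  measurable_fun setT f -> measurable_fun setT g ->
  measurable_fun setT (fun a => k (f a) (g a)).
Proof.
by move=> mf mg; exact: (measurableT_comp hkm (measurable_fun_pair mf mg)).
Qed.

Lemma measurable_dist_feature z : measurable_fun setT (fun x => `|Phi x - Phi z|).
Proof.
rewrite (_ : (fun x => _) =
    (@Num.sqrt R) \o (fun x => k x x - 2 * k x z + k z z)); last first.
  apply/funext => x /=; rewrite -!(dot_feature hk hH) -dot_sqrB -normE sqrtr_sqr.
  by rewrite normr_id.
apply: measurableT_comp.
  apply: continuous_measurable_fun.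
  exact: sqrt_continuous.
apply: measurable_funD => //; apply: measurable_funB.
  exact: measurable_kernel_comp.
by apply: measurable_funM => //; exact: measurable_kernel_comp.
Qed.

Variables (X : {RV P >-> E}) (M : R).
Hypothesis M0 : 0 < M.
Hypothesis XM : {ae P, forall w, k (X w) (X w) <= M ^+ 2}.

Lemma ae_norm_feature_le : {ae P, forall w, `|Phi (X w)| <= M}.
Proof.
move: XM; apply: filterS => w kw.
by rewrite -(@ler_pXn2r _ 2)// ?nnegrE ?(ltW M0)// normE (dot_feature hk hH).
Qed.

(** The approximation s_j maps w to the point of Phi (y_0), ..., Phi (y_j)
    nearest to Phi (X w). The distance r_j tends to 0 and is dominated by r_0,
    so its integral rho_j tends to 0. The expectations of the s_j are within
    rho_i + rho_j of each other, as seen by pairing their difference with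
    itself, and therefore converge. *)
Lemma bochner_expectation_exists :
  exists m, is_bochner_expectation P (fun w => Phi (X w)) m.
Proof.
have [y dense_y] := separable_image_dense Phi (X point) hsep.
pose D l x := `|Phi x - Phi (y l)|.
have mD l : measurable_fun setT (D l) by exact: measurable_dist_feature.
pose J j w := running_argmin D j (X w).
have mJ j : measurable_fun setT (J j).
  by apply: measurableT_comp => //; exact: running_argmin_measurable.
pose s j w := Phi (y (J j w)).
have ss j : simple_vfun (s j).
  split => [|h].
    apply: (@sub_finite_set _ _ ((fun l => Phi (y l)) @` `I_j.+1)).
      move=> _ [w _ <-]; exists (J j w) => //=.
      by rewrite ltnS; exact: running_argmin_le.
    by apply: finite_image; exact: finite_II.
  rewrite (_ : _ @^-1` _ = J j @^-1` [set l | Phi (y l) = h])//.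
  by rewrite -[_ @^-1` _]setTI; apply: mJ.
pose r j w := D (J j w) (X w).
have mr j : measurable_fun setT (r j).
  apply: (@measurableT_comp _ _ _ _ _ _ (fun x => D (running_argmin D j x) x)) => //.
  by apply: measurable_fun_nat_index => //; exact: running_argmin_measurable.
have r0 j w : 0 <= r j w by exact: normr_ge0.
have r_cvg w : r j w @[j --> \oo] --> 0.
  apply/cvgrPdist_lt => e e0.
  have [l De] := dense_y (X w) e e0.
  exists l => // j /= lj; rewrite sub0r normrN ger0_norm ?r0//.
  by apply: le_lt_trans De; exact: running_argmin_min.
have s_cvg w : s j w @[j --> \oo] --> Phi (X w).
  apply/cvgrPdist_lt => e e0.
  move/cvgrPdist_lt : (r_cvg w) => /(_ _ e0); apply: filterS => j.
  by rewrite sub0r normrN normr_id.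
pose b := M + `|Phi (y 0%N)|.
have b0 : 0 <= b by rewrite addr_ge0// ltW.
have r_le : {ae P, forall w j, `|r j w| <= b}.
  have := ae_norm_feature_le; apply: filterS => w Xw j.
  rewrite ger0_norm ?r0// (le_trans (@running_argmin_min _ _ _ D j 0 _ _))//.
  by rewrite (le_trans (ler_normB _ _))// lerD2r.
have ir j : P.-integrable setT (EFin \o r j).
  apply: (ae_bounded_integrable _ b0) => //.
  by move: r_le; apply: filterS => w.
have int_r_cvg : (\int[P]_w (r j w)%:E)%E @[j --> \oo] --> (0 : \bar R)%E.
  have mE j : measurable_fun setT (EFin \o r j) by exact/measurable_EFinP.
  have m0 : measurable_fun setT (cst (0 : \bar R)%E : T -> \bar R).
    exact: measurable_cst.
  have cvgE : {ae P, forall w, setT w ->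
      (EFin \o r j) w @[j --> \oo] --> (0 : \bar R)%E}.
    by apply: nearW => w _; apply: cvg_EFin; [exact: nearW|exact: r_cvg].
  have ib : P.-integrable setT (cst b%:E).
    exact: finite_measure_integrable_cst.
  have leE : {ae P, forall w j, setT w -> (`|(EFin \o r j) w| <= b%:E)%E}.
    by move: r_le; apply: filterS => w rw j _; rewrite lee_fin.
  have [_ _] := dominated_convergence measurableT mE m0 cvgE ib leE.
  by rewrite integral0.
pose rho j := fine (\int[P]_w (r j w)%:E)%E.
have rhoE j : (\int[P]_w (r j w)%:E)%E = (rho j)%:E.
  by rewrite /rho fineK// integrable_fin_num//; exact: ir.
have rho_cvg : rho j @[j --> \oo] --> 0.
  by have /fine_cvgP[_] := int_r_cvg.
pose m j := simple_expectation P (s j).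
have m_dist i j : `|m i - m j| <= rho i + rho j.
  set v := m i - m j; have [->|v0] := eqVneq v 0.
    by rewrite normr0 addr_ge0// -lee_fin -rhoE integral_ge0// => w _; rewrite lee_fin.
  have nv : 0 < `|v| by rewrite normr_gt0.
  rewrite -(ler_pM2r nv) -expr2 normE [in X in X <= _]/v dotBl -/v -lee_fin EFinB.
  have is_ i' : P.-integrable setT (fun w => (dot (s i' w) v)%:E).
    exact: simple_vfun_dot_integrable.
  rewrite /m -!(@simple_expectation_dot _ _ _ P _ dot) // -integralB//.
  have irv : P.-integrable setT (fun w => (`|v|%:E * ((r i w)%:E + (r j w)%:E))%E).
    by apply: integrableZl => //; apply: integrableD => //; exact: ir.
  apply: (@le_trans _ _ (\int[P]_w (`|v|%:E * ((r i w)%:E + (r j w)%:E)))%E).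
    apply: le_integral => //; first exact: integrableB.
    move=> w _ /=; rewrite -?EFinB -?EFinD -?EFinM lee_fin -dotBl.
    rewrite (le_trans (ler_norm _))// (le_trans (norm_cauchy_schwarz normE _ _))//.
    rewrite mulrC ler_wpM2l// /r /D -(subrKA (Phi (X w))).
    by rewrite (le_trans (ler_normD _ _))// lerD// distrC.
  rewrite integralZl//; last by apply: integrableD => //; exact: ir.
  rewrite integralD//; [|exact: ir|exact: ir].
  by rewrite !rhoE -EFinD -EFinM lee_fin mulrC.
have /cvg_ex[m_ mm] : cvg (m j @[j --> \oo]).
  apply/cauchy_cvgP/cauchy_ballP => e e0.
  have e2 : 0 < e / 2 by rewrite divr_gt0.
  move/cvgrPdist_lt : rho_cvg => /(_ _ e2)[N _ hN].
  have rhoN j : (N <= j)%N -> rho j < e / 2.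
    move=> Nj; have := hN j Nj; rewrite /= sub0r normrN.
    exact: le_lt_trans (ler_norm _).
  exists ([set m j | j in [set j | (N <= j)%N]], [set m j | j in [set j | (N <= j)%N]]).
    by split; exists N => // j Nj; exists j.
  move=> [_ _] /= [[i Ni <-] [j Nj <-]]; rewrite -ball_normE /=.
  by rewrite (le_lt_trans (m_dist i j))// (splitr e) ltrD// rhoN.
exists m_, s; split => //; first exact: nearW.
Qed.

Lemma ae_dot_feature_le v : {ae P, forall w, `|dot (Phi (X w)) v| <= M * `|v|}.
Proof.
have := ae_norm_feature_le; apply: filterS => w Xw.
by rewrite (le_trans (norm_cauchy_schwarz normE _ _))// ler_wpM2r.
Qed.

Lemma mean_embedding_dot m v :
  is_bochner_expectation P (fun w => Phi (X w)) m ->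
  measurable_fun setT (ev v) ->
  (\int[P]_w (dot (Phi (X w)) v)%:E = (dot m v)%:E)%E.
Proof.
move=> hm mv.
have mX : measurable_fun setT (fun w => dot (Phi (X w)) v).
  rewrite (_ : (fun w => _) = ev v \o X); first exact: measurableT_comp.
  by apply/funext => w /=; rewrite dotC -(rkhs_reproducing hH).
apply: (bochner_dot normE hm mX).
apply: (ae_bounded_integrable mX _ (ae_dot_feature_le v)).
by rewrite mulr_ge0// ltW.
Qed.

(** As a function on E, the mean embedding is x |-> E k(X, x), a parametrized
    integral of a jointly measurable function. Its measurability lets the
    inner product of Phi (X w) with mean embeddings be integrated. *)
Lemma mean_embedding_measurable m :
  is_bochner_expectation P (fun w => Phi (X w)) m ->
  measurable_fun setT (ev m).
Proof.
move=> hm; pose f (p : E * T) : \bar R := (k (X p.2) p.1)%:E.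
have mf : measurable_fun setT f.
  apply/measurable_EFinP; apply: measurable_kernel_comp => //.
  exact: measurableT_comp.
have -> : ev m = fine \o (fubini_F P f^\+ \- fubini_F P f^\-)%E.
  apply/funext => x /=.
  rewrite (rkhs_reproducing hH) -[LHS]/(fine (dot m (Phi x))%:E) -mean_embedding_dot//.
    rewrite integralE; congr (fine (_ - _)%E).
      by apply: eq_integral => w _; rewrite /f !funeposE /= (dot_feature hk hH).
    by apply: eq_integral => w _; rewrite /f !funenegE /= (dot_feature hk hH).
  rewrite (_ : ev (Phi x) = fun z => k z x); last first.
    by apply/funext => z; rewrite (rkhs_feature hH).
  exact: measurable_kernel_comp.
apply: measurableT_comp => //; apply: emeasurable_funB.
  apply: measurable_fun_fubini_tonelli_F => //.
  exact: measurable_funepos.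
apply: measurable_fun_fubini_tonelli_F => //.
exact: measurable_funeneg.
Qed.

(** |m|^2 = E <Phi X, m> <= M |m|. *)
Lemma mean_embedding_norm_le m :
  is_bochner_expectation P (fun w => Phi (X w)) m -> `|m| <= M.
Proof.
move=> hm; have mm := mean_embedding_measurable hm.
have [->|m0] := eqVneq m 0; first by rewrite normr0 ltW.
have nm : 0 < `|m| by rewrite normr_gt0.
have Mm : 0 <= M * `|m| by rewrite mulr_ge0// ltW.
rewrite -(ler_pM2r nm) -expr2 normE -lee_fin -(mean_embedding_dot hm mm).
have mX : measurable_fun setT (fun w => dot (Phi (X w)) m).
  rewrite (_ : (fun w => _) = ev m \o X); first exact: measurableT_comp.
  by apply/funext => w /=; rewrite dotC -(rkhs_reproducing hH).
apply: le_trans (ae_bounded_le_integral mX Mm (ae_dot_feature_le m)).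
apply: (le_trans (lee_abs _)).
by apply: le_abse_integral => //; exact/measurable_EFinP.
Qed.

Lemma bochner_expectationP :
  is_bochner_expectation P (fun w => Phi (X w))
    (bochner_expectation P (fun w => Phi (X w))).
Proof.
have [m hm] := bochner_expectation_exists.
by rewrite /bochner_expectation; case: xgetP => [//|/(_ m)].
Qed.

End MeanEmbedding.

(** * Independence *)

Section IndependentPair.
Context {d : measure_display} {T : measurableType d} {R : realType}.
Variable P : probability T R.
Context {dA dB : measure_display} {A : measurableType dA} {B : measurableType dB}.
Variables (U : {RV P >-> A}) (V : {RV P >-> B}).
Hypothesis indepUV : forall a b, measurable a -> measurable b ->
  P (U @^-1` a `&` V @^-1` b) = (P (U @^-1` a) * P (V @^-1` b))%E.

(** Independence says that the law of the pair is a product measure. *)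
Lemma independent_pair_fubini (F : A * B -> \bar R) :
  measurable_fun setT F -> (forall p, 0 <= F p)%E ->
  (\int[P]_w F (U w, V w) = \int[P]_w \int[P]_w' F (U w, V w'))%E.
Proof.
move=> mF F0.
have mUV : measurable_fun setT (fun w => (U w, V w)).
  exact: measurable_fun_pair.
pose UV : {RV P >-> (A * B)%type} := HB.pack (fun w => (U w, V w))
  (isMeasurableFun.Build _ _ _ _ _ mUV).
transitivity (\int[distribution P UV]_p F p)%E.
  by rewrite ge0_integral_distribution.
transitivity (\int[distribution P U \x distribution P V]_p F p)%E.
  apply: eq_measure_integral => S mS _; apply/esym.
  by apply: product_measure_unique => // a b ma mb; exact: indepUV.
rewrite fubini_tonelli1// ge0_integral_distribution//; last 2 first.
  exact: measurable_fun_fubini_tonelli_F.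
  by move=> a; apply: integral_ge0.
apply: eq_integral => w _; rewrite /= /fubini_F ge0_integral_distribution//.
exact: measurableT_comp.
Qed.

End IndependentPair.

Section IndependentFamily.
Context {d : measure_display} {T : measurableType d} {R : realType}.
Variable P : probability T R.
Context {d' : measure_display} {E : measurableType d'} {n : nat}.
Variables (X : 'I_n -> {RV P >-> E}) (J : {set 'I_n}).

Definition cylinders : set (set T) :=
  [set B | exists2 A : 'I_n -> set E, (forall j, measurable (A j)) &
     B = \bigcap_(j in [set` J]) (X j @^-1` A j)].

Lemma cylinders_measurable : cylinders `<=` measurable.
Proof.
move=> _ [A mA ->]; apply: fin_bigcap_measurable => // j _.
by rewrite -[_ @^-1` _]setTI; apply: measurable_funP.
Qed.

Lemma cylinders_setI : setI_closed cylinders.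
Proof.
move=> _ _ [A mA ->] [B mB ->]; exists (fun j => A j `&` B j).
  by move=> j; exact: measurableI.
apply/seteqP; split => w.
  by move=> [wA wB] j Jj; split; [exact: wA|exact: wB].
by move=> wAB; split => j Jj; have [] := wAB j Jj.
Qed.

Lemma cylinders_setT : cylinders setT.
Proof. by exists (fun _ => setT) => //; apply/seteqP; split. Qed.

(** The sample space with the sigma-algebra generated by the X j, j in J.
    Working with it rather than with the product space of the values turns a
    function of (X j) for j in J into a function on T. *)
Definition past : measurableType _ := g_sigma_algebraType cylinders.

Definition to_past (w : T) : past := w.

Lemma to_past_measurable : measurable_fun setT to_past.
Proof.
move=> _ B mB; rewrite setTI.
exact: (smallest_sub (@sigma_algebra_measurable _ T) cylinders_measurable).
Qed.

HB.instance Definition _ := isMeasurableFun.Build _ _ _ _ _ to_past_measurable.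

Lemma past_measurable j : j \in J ->
  measurable_fun setT (fun w : past => X j w).
Proof.
move=> Jj _ B mB; rewrite setTI; apply: sub_sigma_algebra.
exists (fun l => if l == j then B else setT).
  by move=> l; case: ifP.
apply/seteqP; split => w /=.
  by move=> Bw l _ /=; case: eqP => [->|].
by move=> /(_ j Jj); rewrite /= eqxx.
Qed.

Hypothesis hX : mutually_independent X.
Variables (i : 'I_n) (iJ : i \notin J).

(** The cylinders form a pi-system that generates the past, and on them the
    product rule is the mutual independence of the family J together with i. *)
Lemma past_independent (a : set past) (b : set E) :
  measurable a -> measurable b ->
  P (to_past @^-1` a `&` X i @^-1` b) =
  (P (to_past @^-1` a) * P (X i @^-1` b))%E.
Proof.
move=> ma mb.
have mXb : measurable (X i @^-1` b).
  by rewrite -[_ @^-1` _]setTI; apply: measurable_funP.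
have p0 : 0 <= fine (P (X i @^-1` b)) by rewrite fine_ge0.
have pE : (fine (P (X i @^-1` b)))%:E = P (X i @^-1` b).
  by rewrite fineK// fin_num_measure.
pose m1 := mrestr P mXb; pose m2 := mscale (NngNum p0) P.
suff : m1 a = m2 a.
  by rewrite /m1 /m2 /= /mrestr /mscale /= pE muleC.
apply: (g_sigma_algebra_measure_unique cylinders _ (fun _ => setT)) => //.
- exact: cylinders_measurable.
- by move=> _; exact: cylinders_setT.
- by rewrite bigcup_const//; exists 0%N.
- exact: cylinders_setI.
- move=> _ [A mA ->].
  pose A' j := if j == i then b else A j.
  have mA' j : measurable (A' j) by rewrite /A'; case: ifP.
  rewrite /m1 /m2 /= /mrestr /mscale /= pE.
  have -> : \bigcap_(j in [set` J]) (X j @^-1` A j) `&` X i @^-1` b =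
      \bigcap_(j in [set` i |: J]) (X j @^-1` A' j).
    apply/seteqP; split => w /=.
      move=> [wA wb] j /=; rewrite in_setU1 /A'.
      by case: eqP => [->//|_ /= Jj]; exact: wA.
    move=> wA; split => [j Jj|].
      have := wA j; rewrite /= in_setU1 Jj orbT => /(_ isT).
      by rewrite /A'; case: eqP => // ji; move: iJ; rewrite -ji Jj.
    by have := wA i; rewrite /= setU11 /A' eqxx => /(_ isT).
  rewrite !hX// big_setU1//= /A' eqxx; congr (_ * _)%E.
  by apply: eq_bigr => j Jj; case: eqP => // ji; move: iJ; rewrite -ji Jj.
- by move=> _; rewrite /m1 /= /mrestr /= setTI -pE ltry.
Qed.

Lemma past_fubini (F : past * E -> \bar R) :
  measurable_fun setT F -> (forall p, 0 <= F p)%E ->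
  (\int[P]_w F (to_past w, X i w) =
   \int[P]_w \int[P]_w' F (to_past w, X i w'))%E.
Proof.
exact: (@independent_pair_fubini _ _ _ P _ _ _ _ to_past (X i) past_independent).
Qed.

End IndependentFamily.

(** * Concentration of sums in the Hilbert space *)

(** With u = 2 a M^2, one step of the moment recursion closes on the bound
    (1 - u N)^-2, thanks to exp u <= 1 / (1 - u). *)
Lemma exp_moment_recursion {R : realType} (u N : R) :
  0 <= u -> 0 <= N -> u * (N + 1) < 1 ->
  expR (2 * u) * (1 - u * (1 + u) * N) ^- 2 <= (1 - u * (N + 1)) ^- 2.
Proof.
move=> u0 N0 uN1.
have uN0 : 0 <= u * N by rewrite mulr_ge0.
have u1 : u < 1 by lra.
have h1 : 0 < 1 - u * (N + 1) by rewrite subr_gt0.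
have uuN : u * (u * N) <= u * 1 by apply: ler_wpM2l => //; lra.
have h2 : 0 < 1 - u * (1 + u) * N by nra.
have eu : expR u * (1 - u) <= 1.
  have := expR_ge1Dx (- u); rewrite -(ler_pM2l (expR_gt0 u)).
  by rewrite expRN mulfV// gt_eqF// expR_gt0.
have key : expR u * (1 - u * (N + 1)) <= 1 - u * (1 + u) * N.
  apply: (@le_trans _ _ (expR u * ((1 - u) * (1 - u * (1 + u) * N)))).
    apply: ler_wpM2l; first exact: expR_ge0.
    rewrite -subr_ge0 [X in 0 <= X](_ : _ = u * (u * (u * N))); last by ring.
    by rewrite !mulr_ge0.
  by rewrite mulrA -[leRHS]mul1r ler_wpM2r// ltW.
rewrite ler_pdivrMr ?exprn_gt0// [leRHS]mulrC ler_pdivlMr ?exprn_gt0//.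
rewrite [2 * u]mulrC expRM_natr.
rewrite -exprMn ler_pXn2r ?nnegrE ?mulr_ge0 ?expR_ge0 ?(ltW h1) ?(ltW h2)//.
Qed.

Section HilbertConcentration.
Context {d : measure_display} {T : measurableType d} {R : realType}.
Variable P : probability T R.
Context {d' : measure_display} {E : measurableType d'} {n : nat}.
Variables (X : 'I_n -> {RV P >-> E}) (hX : mutually_independent X).
Variables (k : E -> E -> R) (hk : psd_kernel k).
Hypothesis hkm : measurable_fun [set: E * E] (fun p : E * E => k p.1 p.2).
Context {H : completeNormedModType R}.
Variables (dot : {dot H for idfun}) (ev : H -> E -> R) (Phi : E -> H).
Hypothesis hH : is_rkhs k dot ev Phi.
Variables (M : R) (M0 : 0 < M).
Hypothesis XM : forall i, {ae P, forall w, k (X i w) (X i w) <= M ^+ 2}.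
Variable mu : 'I_n -> H.
Hypothesis mu_measurable : forall i, measurable_fun setT (ev (mu i)).
Hypothesis mu_dot : forall i v, measurable_fun setT (ev v) ->
  (\int[P]_w (dot (Phi (X i w)) v)%:E = (dot (mu i) v)%:E)%E.
Hypothesis mu_norm : forall i, `|mu i| <= M.

Let normE : forall f : H, `|f| ^+ 2 = dot f f := rkhs_norm hH.
Let sqnorm (v : H) := dot v v.

Definition noise (i : 'I_n) (x : E) : H := Phi x - mu i.

Definition noise_sum (J : {set 'I_n}) (w : T) : H :=
  \sum_(j in J) noise j (X j w).

Lemma noise_dot_measurable {d1} {A : measurableType d1} (i j : 'I_n)
    (f g : A -> E) : measurable_fun setT f -> measurable_fun setT g ->
  measurable_fun setT (fun a => dot (noise i (f a)) (noise j (g a))).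
Proof.
move=> mf mg; rewrite (_ : (fun a => _) = fun a =>
    (k (f a) (g a) - ev (mu j) (f a)) - (ev (mu i) (g a) - dot (mu i) (mu j))).
  apply: measurable_funB; apply: measurable_funB => //.
  - exact: measurable_kernel_comp.
  - exact: measurableT_comp.
  - exact: measurableT_comp.
apply/funext => a; rewrite /noise dotBl !dotBr (dot_feature hk hH).
by rewrite (dotC _ (Phi (f a))) -!(rkhs_reproducing hH).
Qed.

(** For families f and g of measurable maps, inner products of sums of noises
    are finite sums of values of the kernel and of the mean embeddings. This
    replaces the measurability of a map into H and provides joint measurability
    on product spaces. *)
Lemma noise_sum_dot_measurable {d1} {A : measurableType d1} (J J' : {set 'I_n})
    (f g : 'I_n -> A -> E) :
  (forall j, j \in J -> measurable_fun setT (f j)) ->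
  (forall j, j \in J' -> measurable_fun setT (g j)) ->
  measurable_fun setT (fun a => dot (\sum_(j in J) noise j (f j a))
                                    (\sum_(j in J') noise j (g j a))).
Proof.
move=> mf mg; under eq_fun do rewrite dot_suml big_mkcond/=.
apply: measurable_sum => j; case: (boolP (j \in J)) => [Jj|_];
  last exact: measurable_cst.
under eq_fun do rewrite dot_sumr big_mkcond/=.
apply: measurable_sum => l; case: (boolP (l \in J')) => [Jl|_];
  last exact: measurable_cst.
by apply: noise_dot_measurable; [exact: mf|exact: mg].
Qed.

Lemma noise_sum_sqnorm_measurable (J : {set 'I_n}) :
  measurable_fun setT (fun w => sqnorm (noise_sum J w)).
Proof. by apply: noise_sum_dot_measurable => j _; exact: measurable_funP. Qed.

Lemma noise_sum_ev_measurable J w : measurable_fun setT (ev (noise_sum J w)).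
Proof.
rewrite (_ : ev _ = fun x => \sum_(j in J) (k (X j w) x - ev (mu j) x)).
  under eq_fun do rewrite big_mkcond/=.
  apply: measurable_sum => j; case: (boolP (j \in J)) => [Jj|_];
    last exact: measurable_cst.
  by apply: measurable_funB => //; exact: measurable_kernel_comp.
apply/funext => x; rewrite (rkhs_reproducing hH) dot_suml; apply: eq_bigr => j _.
by rewrite dotBl (dot_feature hk hH) -(rkhs_reproducing hH).
Qed.

Lemma ae_noise_sqnorm_le i :
  {ae P, forall w, sqnorm (noise i (X i w)) <= 4 * M ^+ 2}.
Proof.
have := ae_norm_feature_le hk hH M0 (XM i); apply: filterS => w Xw.
have -> : 4 * M ^+ 2 = (M + M) ^+ 2 by ring.
rewrite /sqnorm -normE ler_pXn2r ?nnegrE ?addr_ge0 ?(ltW M0)//.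
by rewrite (le_trans (ler_normB _ _))// lerD.
Qed.

(** Adding an independent centred noise multiplies the exponential moment of
    the squared norm by a constant and inflates its parameter a into
    a (1 + 2 a M^2): expand |s + e|^2 = |s|^2 + 2 <s, e> + |e|^2, bound
    the last term by 4 M^2, and apply Hoeffding's bound to <s, e>, which varies
    in an interval of length 2 M |s|. *)
Lemma exp_moment_add_noise i s a : 0 <= a -> measurable_fun setT (ev s) ->
  (\int[P]_w (expR (a * sqnorm (s + noise i (X i w))))%:E <=
   (expR (4 * a * M ^+ 2) *
    expR (a * (1 + 2 * a * M ^+ 2) * sqnorm s))%:E)%E.
Proof.
move=> a0 ms.
have mXs : measurable_fun setT (fun w => dot (Phi (X i w)) s).
  rewrite (_ : (fun w => _) = ev s \o X i); first exact: measurableT_comp.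
  by apply/funext => w /=; rewrite dotC -(rkhs_reproducing hH).
pose W w := 2 * a * dot (Phi (X i w)) s.
have mW : measurable_fun setT W by exact: measurable_funM.
pose b := 2 * a * (M * `|s|).
have b0 : 0 <= b by rewrite !mulr_ge0// ltW.
have Wb : {ae P, forall w, `|W w| <= b}.
  have := ae_dot_feature_le hk hH M0 (XM i) s; apply: filterS => w h.
  by rewrite normrM ger0_norm ?mulr_ge0// ler_wpM2l// mulr_ge0.
have WE : (\int[P]_w (W w)%:E = (2 * a * dot (mu i) s)%:E)%E.
  rewrite EFinM -mu_dot// -integralZl//.
  apply: (ae_bounded_integrable mXs _ (ae_dot_feature_le hk hH M0 (XM i) s)).
  by rewrite mulr_ge0// ltW.
have hoeff := hoeffding_mgf mW b0 Wb WE.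
pose c := a * sqnorm s + 4 * a * M ^+ 2 - 2 * a * dot (mu i) s.
have msum : measurable_fun setT (fun w => sqnorm (s + noise i (X i w))).
  rewrite (_ : (fun w => _) = fun w => (sqnorm s +
      2 * (dot (Phi (X i w)) s - dot (mu i) s)) +
      dot (noise i (X i w)) (noise i (X i w))).
    apply: measurable_funD; last exact: noise_dot_measurable.
    by apply: measurable_funD => //; apply: measurable_funM => //; exact: measurable_funB.
  apply/funext => w; rewrite /sqnorm dot_sqrD; congr (_ + _ + _).
  by rewrite /noise dotBr !(dotC dot s).
apply: (@le_trans _ _ (\int[P]_w ((expR c)%:E * (expR (W w))%:E))%E).
  apply: ae_ge0_le_integral => //.
  - apply/measurable_EFinP; apply: measurableT_comp => //.
    exact: measurable_funM.
  - apply: emeasurable_funM => //; apply/measurable_EFinP => //.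
    exact: measurableT_comp.
  - have := ae_noise_sqnorm_le i; apply: filterS => w h _.
    rewrite -EFinM lee_fin -expRD ler_expR /sqnorm dot_sqrD /c /W.
    have : a * sqnorm (noise i (X i w)) <= a * (4 * M ^+ 2) by exact: ler_wpM2l.
    rewrite /sqnorm; set e := noise i (X i w).
    have -> : dot s e = dot (Phi (X i w)) s - dot (mu i) s.
      by rewrite /e /noise dotBr !(dotC dot s).
    nra.
rewrite ge0_integralZl//; last by apply/measurable_EFinP; exact: measurableT_comp.
apply: (le_trans (lee_wpmul2l _ hoeff)); first by rewrite lee_fin expR_ge0.
rewrite -EFinM lee_fin -!expRD ler_expR /c /b !exprMn normE /sqnorm.
rewrite le_eqVlt; apply/orP; left; apply/eqP; by field.
Qed.

(** Removing one index i of J, the sum over the other indices is frozen by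
    independence and the noise at i is integrated first. The parameter grows
    from a to a (1 + 2 a M^2) but stays below the pole of the bound for the
    smaller set. *)
Lemma exp_moment_noise_sum (J : {set 'I_n}) a :
  0 <= a -> 2 * M ^+ 2 * a * #|J|%:R < 1 ->
  (\int[P]_w (expR (a * sqnorm (noise_sum J w)))%:E <=
   ((1 - 2 * M ^+ 2 * a * #|J|%:R) ^- 2)%:E)%E.
Proof.
move: {2}#|J| (erefl #|J|) => N; elim: N J a => [|N IH] J a cJ a0 aJ.
  move/eqP: cJ; rewrite cards_eq0 => /eqP->.
  under eq_integral do rewrite /noise_sum big_set0 /sqnorm dot0l mulr0 expR0.
  rewrite integral_cst// [X in (_ * X)%E]probability_setT mule1.
  by rewrite cards0 mulr0 subr0 expr1n invr1.
have [i Ji] : exists i, i \in J by apply/set0Pn; rewrite -cards_eq0 cJ.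
pose K := J :\ i.
have iK : i \notin K by rewrite !inE eqxx.
have cK : #|K| = N by move: cJ; rewrite (cardsD1 i) Ji => -[].
pose u := 2 * M ^+ 2 * a.
have u0 : 0 <= u by rewrite !mulr_ge0// ?exprn_ge0 ?(ltW M0).
have uN : u * (N%:R + 1) < 1.
  by move: aJ; rewrite cJ -[N.+1%:R]natr1.
pose F (p : past X K * E) : \bar R :=
  (expR (a * sqnorm ((\sum_(j in K) noise j (X j p.1)) + noise i p.2)))%:E.
have mF : measurable_fun setT F.
  apply/measurable_EFinP; apply: measurableT_comp => //; apply: measurable_funM => //.
  pose f (j : 'I_n) (p : past X K * E) := if j == i then p.2 else X j p.1.
  rewrite (_ : (fun p => _) = fun p => dot (\sum_(j in J) noise j (f j p))
     (\sum_(j in J) noise j (f j p))).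
    have mf j : j \in J -> measurable_fun setT (f j).
      move=> Jj; rewrite /f; case: eqP => [_|/eqP ji]; first exact: measurable_snd.
      have Kj : j \in K by rewrite !inE ji.
      exact: (measurableT_comp (past_measurable (X := X) Kj) measurable_fst).
    exact: noise_sum_dot_measurable.
  apply/funext => p; rewrite /sqnorm [in RHS](big_setD1 i Ji)/= [in RHS]addrC.
  rewrite /f eqxx.
  by congr (dot (_ + _) (_ + _)); apply: eq_bigr => j; rewrite !inE => /andP[/negPf->].
have -> : (\int[P]_w (expR (a * sqnorm (noise_sum J w)))%:E =
    \int[P]_w F (to_past X K w, X i w))%E.
  apply: eq_integral => w _; rewrite /F /noise_sum [in LHS](big_setD1 i Ji)/=.
  by rewrite addrC.
rewrite past_fubini//; last by move=> p; rewrite lee_fin expR_ge0.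
pose a' := a * (1 + u).
apply: (@le_trans _ _ (\int[P]_w ((expR (2 * u))%:E *
   (expR (a' * sqnorm (noise_sum K w)))%:E))%E).
  apply: ge0_le_integral_nonmeasurable => w.
    by apply: integral_ge0 => w' _; rewrite lee_fin expR_ge0.
  rewrite /F /= -EFinM.
  apply: le_trans (exp_moment_add_noise i a0 (noise_sum_ev_measurable K w)) _.
  rewrite lee_fin le_eqVlt; apply/orP; left; apply/eqP.
  by congr (expR _ * expR _); rewrite /a' /u; ring.
rewrite ge0_integralZl//; last first.
  apply/measurable_EFinP; apply: measurableT_comp => //; apply: measurable_funM => //.
  exact: noise_sum_sqnorm_measurable.
have a'0 : 0 <= a' by rewrite mulr_ge0// addr_ge0.
have a'E : 2 * M ^+ 2 * a' = u * (1 + u) by rewrite /a' /u; ring.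
have N0 : 0 <= N%:R :> R by [].
have a'K : 2 * M ^+ 2 * a' * #|K|%:R < 1.
  rewrite a'E cK; have : u * (u * N%:R) <= u * 1 by apply: ler_wpM2l => //; lra.
  nra.
apply: (le_trans (lee_wpmul2l _ (IH K a' cK a'0 a'K))).
  by rewrite lee_fin expR_ge0.
by rewrite -EFinM lee_fin a'E cK cJ -[N.+1%:R]natr1 exp_moment_recursion.
Qed.

End HilbertConcentration.

Lemma measure_bigsetU_le {d} {T : measurableType d} {R : realType}
    (mu : {measure set T -> \bar R}) (I : Type) (r : seq I) (A : I -> set T) :
  (forall i, measurable (A i)) ->
  (mu (\big[setU/set0]_(i <- r) A i) <= \sum_(i <- r) mu (A i))%E.
Proof.
move=> mA; elim: r => [|i r IH]; first by rewrite !big_nil measure0.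
rewrite !big_cons (le_trans (measureU2 _ _ _))//; first exact: bigsetU_measurable.
by rewrite leeD2l.
Qed.

Section UniformNoiseBound.
Context {d : measure_display} {T : measurableType d} {R : realType}.
Variable P : probability T R.
Context {d' : measure_display} {E : measurableType d'} {n : nat}.
Variables (X : 'I_n -> {RV P >-> E}) (hX : mutually_independent X).
Variables (k : E -> E -> R) (hk : psd_kernel k).
Hypothesis hkm : measurable_fun [set: E * E] (fun p : E * E => k p.1 p.2).
Context {H : completeNormedModType R}.
Variables (dot : {dot H for idfun}) (ev : H -> E -> R) (Phi : E -> H).
Hypotheses (hH : is_rkhs k dot ev Phi) (hsep : separable H).
Variables (M : R) (M0 : 0 < M).
Hypothesis XM : forall i, {ae P, forall w, k (X i w) (X i w) <= M ^+ 2}.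

Let mu i := bochner_expectation P (fun w => Phi (X i w)).
Let S := noise_sum X Phi mu.

Let mu_measurable i : measurable_fun setT (ev (mu i)).
Proof.
apply: (mean_embedding_measurable hk hkm hH M0 (XM i)).
exact: (bochner_expectationP hk hkm hH hsep M0 (XM i)).
Qed.

Let mu_dot i v : measurable_fun setT (ev v) ->
  (\int[P]_w (dot (Phi (X i w)) v)%:E = (dot (mu i) v)%:E)%E.
Proof.
move=> mv; apply: (mean_embedding_dot hk hH M0 (XM i)) => //.
exact: (bochner_expectationP hk hkm hH hsep M0 (XM i)).
Qed.

Let mu_norm i : `|mu i| <= M.
Proof.
apply: (mean_embedding_norm_le hk hkm hH M0 (XM i)).
exact: (bochner_expectationP hk hkm hH hsep M0 (XM i)).
Qed.

(** The parameter 1 / (4 M^2 N) halves the distance to the pole of the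
    exponential moment, whose bound is then 4. *)
Lemma noise_sum_tail (J : {set 'I_n}) (x : R) : (0 < #|J|)%N ->
  (P [set w | #|J|%:R * (8 * M ^+ 2 * x) <= dot (S J w) (S J w)]%R <=
   (4 * expR (- (2 * x)))%:E)%E.
Proof.
move=> J0; set N : R := #|J|%:R; have N0 : 0 < N by rewrite ltr0n.
pose a := (4 * M ^+ 2 * N)^-1.
have D0 : 0 < 4 * M ^+ 2 * N by rewrite !mulr_gt0// exprn_gt0.
have a0 : 0 < a by rewrite invr_gt0.
have mS : measurable_fun setT (fun w => dot (S J w) (S J w)).
  exact: (noise_sum_sqnorm_measurable X hk hkm hH mu_measurable).
pose Z : {RV P >-> R} := HB.pack (fun w => dot (S J w) (S J w))
  (isMeasurableFun.Build _ _ _ _ _ mS).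
have := chernoff Z (N * (8 * M ^+ 2 * x)) a0.
rewrite (_ : a * _ = 2 * x); last first.
  by rewrite /a; field; rewrite !gt_eqF// exprn_gt0.
move=> /le_trans; apply; rewrite EFinM; apply: lee_wpmul2r.
  by rewrite lee_fin expR_ge0.
have aN : 2 * M ^+ 2 * a * N = 2^-1.
  by rewrite /a; field; rewrite !gt_eqF// exprn_gt0.
have aN1 : 2 * M ^+ 2 * a * N < 1 by rewrite aN invf_lt1// ltr1n.
have := exp_moment_noise_sum hX hk hkm hH M0 XM mu_measurable mu_dot mu_norm
  (ltW a0) aN1.
rewrite -/N aN (_ : (1 - 2^-1) ^- 2 = 4 :> R); last by field.
apply: le_trans; rewrite /mmt_gen_fun unlock /=.
by under eq_integral do rewrite mulrC.
Qed.

Definition ord_interval (p q : 'I_n) : {set 'I_n} :=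
  [set l : 'I_n | (p <= l <= q)%N]%SET.

(** A union bound over the n^2 pairs of endpoints: each exceptional set has
    probability at most 4 exp (- 2 (y + ln n + 1)) <= exp (- y) / n^2, where
    the term 1 absorbs the factor 4. *)
Lemma uniform_noise_bound (y : R) : (0 < n)%N -> 0 < y ->
  exists Omega : set T, [/\ measurable Omega,
    ((1 - expR (- y))%:E <= P Omega)%E &
    forall w, Omega w -> forall p q : 'I_n,
      dot (S (ord_interval p q) w) (S (ord_interval p q) w) <=
      #|ord_interval p q|%:R * (8 * M ^+ 2 * (y + ln n%:R + 1))].
Proof.
move=> n0 y0; set x := y + ln n%:R + 1.
pose bad (p : 'I_n * 'I_n) : set T := [set w |
  #|ord_interval p.1 p.2|%:R * (8 * M ^+ 2 * x) <
  dot (S (ord_interval p.1 p.2) w) (S (ord_interval p.1 p.2) w)].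
have mbad p : measurable (bad p).
  rewrite -[bad p]setTI.
  apply: (@measurable_fun_ltr _ _ _ setT (cst _) _ _ _ measurableT [set true]) => //.
  exact: (noise_sum_sqnorm_measurable X hk hkm hH mu_measurable).
have n0R : 0 < n%:R :> R by rewrite ltr0n.
have Pbad p : (P (bad p) <= (expR (- y) / n%:R ^+ 2)%:E)%E.
  have [/eqP c0|c0] := posnP #|ord_interval p.1 p.2|.
    rewrite (_ : bad p = set0) ?measure0 ?lee_fin ?divr_ge0 ?expR_ge0//.
    apply/seteqP; split => // w; rewrite /bad /= (eqP c0) mul0r.
    move: c0; rewrite cards_eq0 => /eqP ->.
    by rewrite /S /noise_sum big_set0 dot0l ltxx.
  apply: (@le_trans _ _ (4 * expR (- (2 * x)))%:E).
    apply: le_trans (noise_sum_tail x c0); apply: le_measure; rewrite ?inE//.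
      rewrite -[X in measurable X]setTI.
      apply: (@measurable_fun_ler _ _ _ setT (cst _) _ _ _ measurableT [set true]) => //.
      exact: (noise_sum_sqnorm_measurable X hk hkm hH mu_measurable).
    by move=> w; rewrite /bad /=; exact: ltW.
  rewrite lee_fin (_ : - (2 * x) = (- y - y - 1 - 1) - ln (n%:R ^+ 2)); last first.
    by rewrite lnXn// /x; ring.
  rewrite expRD expRN lnK ?posrE ?exprn_gt0// mulrA ler_pM2r ?invr_gt0 ?exprn_gt0//.
  rewrite !expRD.
  have e1 : expR (- (1 : R)) <= 2^-1.
    by rewrite expRN lef_pV2 ?posrE ?expR_gt0//; have := expR_ge1Dx (1 : R); lra.
  have ey : expR (- y) <= 1 by rewrite -[leRHS]expR0 ler_expR; lra.
  have := expR_ge0 (- y); have := expR_ge0 (- (1 : R)).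
  move: (expR (- y)) (expR (- 1)) e1 ey => u v v2 u1 v0 u0.
  have vv : v * v <= 2^-1 * 2^-1 by apply: ler_pM.
  have uu : u * u <= u * 1 by apply: ler_wpM2l.
  rewrite [leLHS](_ : _ = 4 * ((u * u) * (v * v))); last by ring.
  have : u * u * (v * v) <= (u * 1) * (2^-1 * 2^-1).
    by apply: ler_pM => //; rewrite mulr_ge0.
  lra.
pose Bad := \big[setU/set0]_(p <- index_enum ('I_n * 'I_n)%type) bad p.
have mBad : measurable Bad by exact: bigsetU_measurable.
exists (~` Bad); split; first exact: measurableC.
  rewrite probability_setC// EFinB leeB//.
  apply: (le_trans (measure_bigsetU_le P _ mbad)).
  apply: (@le_trans _ _ (\sum_(p : 'I_n * 'I_n) (expR (- y) / n%:R ^+ 2)%:E)%E).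
    by apply: lee_sum => p _; exact: Pbad.
  rewrite sumEFin lee_fin sumr_const card_prod !card_ord -[_ *+ (n * n)]mulr_natr natrM.
  by rewrite -expr2 divfK// gt_eqF// exprn_gt0.
move=> w nBad p q; rewrite leNgt; apply/negP => lt; apply: nBad.
by rewrite /Bad (bigD1_seq (p, q)) ?mem_index_enum ?index_enum_uniq//=; left.
Qed.

End UniformNoiseBound.

(** * Block means *)

Section BlockMeans.
Context {R : realType} {H : lmodType R}.
Variable dot : {dot H for idfun}.
Context {n : nat}.
Implicit Types (c : 'I_n -> nat) (u v : 'I_n -> H).

Definition block_sum c v (l : nat) : H := \sum_(j | c j == l) v j.

Definition block_card c (l : nat) : nat := #|[pred j | c j == l]|.

(** The orthogonal projection of v onto the families that are constant on the
    level sets of c. *)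
Definition block_mean c v (i : 'I_n) : H :=
  (block_card c (c i))%:R^-1 *: block_sum c v (c i).

Definition block_residual c v (i : 'I_n) : H := v i - block_mean c v i.

(** The inner product of the direct sum of n copies of H. *)
Definition ip u v : R := \sum_i dot (u i) (v i).

Definition constant_on_blocks c v := forall i j, c i = c j -> v i = v j.

Lemma ipC u v : ip u v = ip v u.
Proof. by apply: eq_bigr => i _; rewrite dotC. Qed.

Lemma ipDl u v w : ip (fun i => u i + v i) w = ip u w + ip v w.
Proof. by rewrite -big_split; apply: eq_bigr => i _; rewrite dotDl. Qed.

Lemma ipBl u v w : ip (fun i => u i - v i) w = ip u w - ip v w.
Proof. by rewrite /ip -sumrB; apply: eq_bigr => i _; rewrite dotBl. Qed.

Lemma ipZl a u w : ip (fun i => a *: u i) w = a * ip u w.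
Proof. by rewrite /ip mulr_sumr; apply: eq_bigr => i _; rewrite dotZl. Qed.

Lemma ipDr u v w : ip w (fun i => u i + v i) = ip w u + ip w v.
Proof. by rewrite ipC ipDl !(ipC w). Qed.

Lemma ipBr u v w : ip w (fun i => u i - v i) = ip w u - ip w v.
Proof. by rewrite ipC ipBl !(ipC w). Qed.

Lemma ipZr a u w : ip w (fun i => a *: u i) = a * ip w u.
Proof. by rewrite ipC ipZl (ipC w). Qed.

Lemma ip_ge0 u : 0 <= ip u u.
Proof. by apply: sumr_ge0 => i _; exact: dotvv_ge0. Qed.

Lemma block_card_gt0 c i : (0 < block_card c (c i))%N.
Proof. by apply/card_gt0P; exists i; rewrite inE. Qed.

Lemma block_meanD c u v :
  block_mean c (fun i => u i + v i) = fun i => block_mean c u i + block_mean c v i.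
Proof. by apply/funext => i; rewrite /block_mean /block_sum big_split scalerDr. Qed.

Lemma block_mean_constant c c' v : (forall i j, c i = c j -> c' i = c' j) ->
  constant_on_blocks c (block_mean c' v).
Proof. by move=> cc' i j /cc' cij; rewrite /block_mean cij. Qed.

Lemma block_mean_id c v : constant_on_blocks c v -> block_mean c v = v.
Proof.
move=> cv; apply/funext => i; rewrite /block_mean /block_sum.
rewrite (eq_bigr (fun=> v i)) => [|j /eqP/cv//].
rewrite sumr_const -[X in _ *: X]scaler_nat scalerA -/(block_card c (c i)).
by rewrite mulVf ?scale1r// pnatr_eq0 -lt0n block_card_gt0.
Qed.

(** Block averaging is self-adjoint; being also idempotent, it is the orthogonal
    projection. *)
Lemma ip_block_mean c u v : ip (block_mean c u) v = ip u (block_mean c v).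
Proof.
rewrite /ip /block_mean.
under eq_bigr do rewrite dotZl dot_suml mulr_sumr big_mkcond.
under [RHS]eq_bigr do rewrite dotZr dot_sumr mulr_sumr big_mkcond.
rewrite exchange_big; apply: eq_bigr => i _; apply: eq_bigr => j _.
by rewrite eq_sym; case: eqP => // ->.
Qed.

Lemma ip_block_mean_r c u v : constant_on_blocks c u ->
  ip u (block_mean c v) = ip u v.
Proof. by move=> cu; rewrite -ip_block_mean block_mean_id. Qed.

Lemma ip_block_meanK c v :
  ip (block_mean c v) (block_mean c v) = ip (block_mean c v) v.
Proof. by apply: ip_block_mean_r; exact: block_mean_constant. Qed.

Lemma sum_by_blocks c D (F : 'I_n -> R) : (forall i, (c i < D)%N) ->
  \sum_i F i = \sum_(0 <= l < D) \sum_(i | c i == l) F i.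
Proof.
move=> cD; under [RHS]eq_bigr do rewrite big_mkcond.
rewrite exchange_big; apply: eq_bigr => i _ /=.
rewrite -big_mkcond big_mkord (bigD1 (Ordinal (cD i)))//= big1 ?addr0// => l.
by move=> /andP[/eqP cil /eqP[]]; apply: val_inj.
Qed.

Lemma ip_block_mean_sum c D v : (forall i, (c i < D)%N) ->
  ip (block_mean c v) (block_mean c v) =
  \sum_(0 <= l < D)
    (block_card c l)%:R^-1 * dot (block_sum c v l) (block_sum c v l).
Proof.
move=> cD; rewrite /ip (sum_by_blocks _ cD); apply: eq_bigr => l _.
rewrite (eq_bigr (fun=> (block_card c l)%:R^-1 * ((block_card c l)%:R^-1 *
    dot (block_sum c v l) (block_sum c v l)))); last first.
  by move=> i /eqP <-; rewrite dotZl dotZr.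
rewrite sumr_const -[LHS]mulr_natl -/(block_card c l) mulrA.
have [->|N0] := posnP (block_card c l); first by rewrite invr0 !mul0r.
by rewrite mulrA divff ?mul1r// pnatr_eq0 -lt0n.
Qed.

(** With a the part of the signal m that c misses and p, b the projections of
    the noise onto c and onto the finer s, expanding |th a + b - p|^2 >= 0
    bounds the cross term -2 <a, e> = -2 <a, b> together with |p|^2; a is
    orthogonal to p and <p, b> = |p|^2. The projection of the noise onto
    cstar only helps and is dropped. *)
Lemma block_mean_gap c cstar s (m e : 'I_n -> H) (th gap : R) :
  (forall i j, s i = s j -> c i = c j) ->
  (forall i j, s i = s j -> cstar i = cstar j) ->
  constant_on_blocks cstar m -> 0 < th -> th <= 1 ->
  let Y i := m i + e i in
  ip (block_mean cstar Y) (block_mean cstar Y) + gap <=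
    ip (block_mean c Y) (block_mean c Y) ->
  (1 - th) * ip (block_residual c m) (block_residual c m) + gap <=
    ip (block_mean s e) (block_mean s e) / th.
Proof.
move=> sc scs mcs th0 th1 Y hgap.
rewrite !ip_block_meanK {}/Y !block_meanD !ipDl !ipDr in hgap.
rewrite (block_mean_id mcs) (ip_block_mean cstar e m) (block_mean_id mcs) in hgap.
rewrite (ip_block_mean c e m) (ipC e m) (ipC e (block_mean c m)) in hgap.
set a := block_residual c m.
set p := block_mean c e; set b := block_mean s e.
have ms : constant_on_blocks s m by move=> i j /scs/mcs.
have as_ : constant_on_blocks s a.
  move=> i j sij; rewrite /a /block_residual (ms i j)//; congr (_ - _).
  exact: block_mean_constant sij.
have ps : constant_on_blocks s p by exact: block_mean_constant.
have ab : ip a b = ip a e by exact: ip_block_mean_r.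
have pb : ip p b = ip p e by exact: ip_block_mean_r.
have pp : ip p p = ip p e by exact: ip_block_meanK.
have a_orth v : constant_on_blocks c v -> ip a v = 0.
  by move=> cv; rewrite ipBl ip_block_mean (block_mean_id cv) subrr.
have ap : ip a p = 0 by apply: a_orth; exact: block_mean_constant.
have aa : ip a a = ip m m - ip (block_mean c m) m.
  rewrite {2}/a ipBr (a_orth (block_mean c m)) ?subr0 ?ipBl//.
  exact: block_mean_constant.
have ae : ip a e = ip m e - ip (block_mean c m) e by rewrite ipBl.
have sq := ip_ge0 (fun i => (th *: a i + b i) - p i).
rewrite ipBl !ipBr !ipDl !ipDr !ipZl !ipZr in sq.
rewrite (ipC b a) (ipC p a) (ipC b p) ap pb pp ab in sq.
have qstar : 0 <= ip (block_mean cstar e) e by rewrite -ip_block_meanK ip_ge0.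
have qp : 0 <= ip p e by rewrite -pp ip_ge0.
rewrite -/p in hgap.
have hgap' : gap <= ip p e - ip a a - 2 * ip a e by rewrite aa ae; lra.
have thgap : th * gap <= th * (ip p e - ip a a - 2 * ip a e) by rewrite ler_pM2l.
have thp : th * ip p e <= 1 * ip p e by exact: ler_wpM2r.
rewrite ler_pdivlMr//; nra.
Qed.

End BlockMeans.

(** * Segmentations *)

Lemma card_ord_range (n a b : nat) : (b <= n)%N ->
  #|[pred i : 'I_n | (a <= i < b)%N]| = (b - a)%N.
Proof.
move=> bn; rewrite -sum1_card (eq_bigl (fun i : 'I_n => (a <= i < b)%N))//.
rewrite -(big_mkord (fun i => (a <= i < b)%N) (fun=> 1%N)).
rewrite (eq_bigl (fun i => (a <= i)%N && (i < b)%N))//.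
rewrite -big_nat_widen// (eq_bigl (fun i => true && (a <= i)%N))//.
by rewrite -big_nat_widenl// sum_nat_const_nat muln1.
Qed.

Lemma bigmin_le (n a b j : nat) (F : nat -> nat) : (a <= j < b)%N ->
  (\big[minn/n]_(a <= l < b) F l <= F j)%N.
Proof.
move=> jab; have : j \in index_iota a b by rewrite mem_index_iota.
elim: (index_iota a b) => //= x r IH; rewrite inE big_cons => /predU1P[<-|jr].
  exact: geq_minl.
by apply: leq_trans (geq_minr _ _) _; exact: IH.
Qed.

Section Segmentation.
Context {n : nat}.
Variable t : segmentation n.

Lemma nbseg_gt0 : (0 < nbseg t)%N.
Proof.
have /and4P[t1 _ _ _] := breakpointsP t.
by rewrite /nbseg -subn1 subn_gt0.
Qed.

Lemma size_breakpoints : size t = (nbseg t).+1.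
Proof.
have /and4P[t1 _ _ _] := breakpointsP t.
by rewrite /nbseg prednK// ltnW.
Qed.

Lemma bp0 : bp t 0 = 0%N.
Proof. by have /and4P[_ /eqP t0 _ _] := breakpointsP t. Qed.

Lemma bp_last : bp t (nbseg t) = n.
Proof. by have /and4P[_ _ /eqP tn _] := breakpointsP t; rewrite /bp nth_last. Qed.

Lemma bp_lt l m : (l < m)%N -> (m <= nbseg t)%N -> (bp t l < bp t m)%N.
Proof.
have /and4P[_ _ _ st] := breakpointsP t => lm mD.
apply: (sorted_ltn_nth ltn_trans 0%N st) => //; rewrite inE size_breakpoints ltnS//.
exact: leq_trans (ltnW lm) mD.
Qed.

Lemma bp_le l m : (l <= m)%N -> (m <= nbseg t)%N -> (bp t l <= bp t m)%N.
Proof.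
rewrite leq_eqVlt => /predU1P[->//|lm mD]; exact/ltnW/bp_lt.
Qed.

Lemma bp_le_n l : (l <= nbseg t)%N -> (bp t l <= n)%N.
Proof. by move=> lD; rewrite -[leqRHS]bp_last bp_le. Qed.

(** The index of the segment that contains i. Counting the interior breakpoints
    at or before i makes it visibly monotone, and constant where there is no
    breakpoint. *)
Definition seg_label (i : 'I_n) : nat :=
  (\sum_(1 <= j < nbseg t) (bp t j <= i))%N.

Lemma seg_label_mono (i j : 'I_n) : (i <= j)%N -> (seg_label i <= seg_label j)%N.
Proof.
move=> ij; apply: leq_sum => l _; case: (leqP (bp t l) i) => // li.
by rewrite (leq_trans li ij).
Qed.

Lemma seg_label_lt i : (seg_label i < nbseg t)%N.
Proof.
have /leq_ltn_trans -> // : (seg_label i <= \sum_(1 <= j < nbseg t) 1)%N.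
  by apply: leq_sum => l _; exact: leq_b1.
by rewrite sum_nat_const_nat muln1 subn1 prednK ?nbseg_gt0.
Qed.

Lemma seg_label_const (i j : 'I_n) : (i <= j)%N ->
  (forall l, (1 <= l < nbseg t)%N -> ~~ (i < bp t l <= j)%N) ->
  seg_label i = seg_label j.
Proof.
move=> ij no; apply: eq_big_nat => l /no.
by case: (leqP (bp t l) i) => //= [li _|_ /negPf->//]; rewrite (leq_trans li ij).
Qed.

Lemma in_seg_label l i : (l < nbseg t)%N -> in_seg t l i -> seg_label i = l.
Proof.
move=> lD /andP[li il]; rewrite /seg_label.
rewrite (eq_big_nat _ _ (F2 := fun j => if true && (j < l.+1)%N then 1%N else 0%N)).
  by rewrite -big_mkcond -big_nat_widen// sum_nat_const_nat muln1 subSS subn0.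
move=> j /andP[j1 jD] /=; rewrite ltnS; case: (leqP j l) => jl.
  by rewrite (leq_trans (bp_le jl (ltnW lD))).
by rewrite leqNgt (leq_trans il)// bp_le// ltnW.
Qed.

Lemma in_segE l i : (l < nbseg t)%N -> in_seg t l i = (seg_label i == l).
Proof.
move=> lD; apply/idP/eqP => [|<-]; first exact: in_seg_label.
have [m [mD im]] : exists m, (m < nbseg t)%N /\ in_seg t m i.
  have ex0 : exists m, (m < nbseg t)%N && (bp t m <= i)%N.
    by exists 0%N; rewrite nbseg_gt0 bp0.
  have ub m : (m < nbseg t)%N && (bp t m <= i)%N -> (m <= nbseg t)%N.
    by move=> /andP[/ltnW].
  have [m /andP[mD mi] maxm] := ex_maxnP ex0 ub.
  exists m; split=> //; rewrite /in_seg mi /=; move: (mD).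
  rewrite leq_eqVlt => /predU1P[->|mD']; first by rewrite bp_last.
  by rewrite ltnNge; apply/negP => mi'; have := maxm m.+1; rewrite mD' mi' ltnn => /(_ isT).
by rewrite (in_seg_label mD im).
Qed.

Lemma block_card_seg l : (l < nbseg t)%N -> block_card seg_label l = seglen t l.
Proof.
move=> lD; rewrite /seglen -(@card_ord_range n)//; last exact: bp_le_n.
by apply: eq_card => i; rewrite !inE -in_segE.
Qed.

End Segmentation.

Section MonotoneLabels.
Context {n : nat}.
Variable c : 'I_n -> nat.
Hypothesis c_mono : forall i j : 'I_n, (i <= j)%N -> (c i <= c j)%N.

(** The endpoints are the least and the greatest element of the level set. *)
Lemma level_set_interval l : (0 < block_card c l)%N ->
  exists p q, forall j, (c j == l) = (j \in ord_interval p q).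
Proof.
move=> /card_gt0P[i0]; rewrite inE => ci0.
have [p cp pmin] := @arg_minnP _ i0 (fun i => c i == l) (fun i => i : nat) ci0.
have [q cq qmax] := @arg_maxnP _ i0 (fun i => c i == l) (fun i => i : nat) ci0.
exists p, q => j; rewrite inE; apply/idP/idP => [cj|/andP[pj jq]].
  by rewrite pmin //=; exact: qmax.
by rewrite eqn_leq -{1}(eqP cq) -(eqP cp) !c_mono.
Qed.

End MonotoneLabels.

Section TwoSegmentations.
Context {n : nat}.
Variables t1 t2 : segmentation n.

(** Both labels increase along 'I_n, so their sum determines them: its level
    sets are the nonempty intersections of segments of t1 and t2. *)
Definition common_label (i : 'I_n) : nat := (seg_label t1 i + seg_label t2 i)%N.

Lemma common_label_mono (i j : 'I_n) :
  (i <= j)%N -> (common_label i <= common_label j)%N.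
Proof. by move=> ij; apply: leq_add; exact: seg_label_mono. Qed.

Lemma common_label_lt i : (common_label i < (nbseg t1 + nbseg t2).-1)%N.
Proof.
rewrite /common_label; have := seg_label_lt t1 i; have := seg_label_lt t2 i; lia.
Qed.

Lemma common_label_refines (i j : 'I_n) : common_label i = common_label j ->
  seg_label t1 i = seg_label t1 j /\ seg_label t2 i = seg_label t2 j.
Proof.
wlog ij : i j / (i <= j)%N => [wl|].
  move=> e; have [ij|/ltnW ji] := leqP i j; first exact: wl.
  by have [-> ->] := wl j i ji (esym e).
have := seg_label_mono t1 ij; have := seg_label_mono t2 ij.
rewrite /common_label; lia.
Qed.

(** If every interior breakpoint of t1 had an interior breakpoint of t2 at
    distance less than half the smallest segment of t1, choosing one for each
    would be injective. *)
Lemma isolated_breakpoint (L dl : nat) :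
  (forall l, (l < nbseg t1)%N -> (L <= seglen t1 l)%N) ->
  (dl.*2 <= L.+1)%N -> (nbseg t2 < nbseg t1)%N ->
  exists i, (1 <= i < nbseg t1)%N /\ forall j, (1 <= j < nbseg t2)%N ->
     (dl <= `|(bp t1 i)%:Z - (bp t2 j)%:Z|)%N.
Proof.
move=> hL hdl D21; apply: contrapT => hno.
have near (i : 'I_(nbseg t1).-1) : exists j : 'I_(nbseg t2).-1,
    (`|(bp t1 i.+1)%:Z - (bp t2 j.+1)%:Z| < dl)%N.
  apply: contrapT => nj; apply: hno; exists i.+1; split.
    by have := ltn_ord i; lia.
  move=> j j2; rewrite leqNgt; apply/negP => lt; apply: nj.
  have j' : (j.-1 < (nbseg t2).-1)%N by lia.
  by exists (Ordinal j') => /=; rewrite prednK//; lia.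
pose f i := projT1 (cid (near i)).
have fP (i : 'I_(nbseg t1).-1) :
    (`|(bp t1 i.+1)%:Z - (bp t2 (f i).+1)%:Z| < dl)%N.
  exact: projT2 (cid (near i)).
suff /leq_card : injective f by rewrite !card_ord; have := nbseg_gt0 t2; lia.
suff inj (i j : 'I_(nbseg t1).-1) : (i < j)%N -> f i <> f j.
  move=> i j fij; apply: val_inj => /=.
  by case: (ltngtP i j) => // ij; have := inj _ _ ij; rewrite fij.
move=> ij fij; have := fP i; have := fP j; rewrite fij.
have := hL i.+1; rewrite /seglen.
have iD : (i.+1 < nbseg t1)%N by have := ltn_ord i; lia.
have : (bp t1 i.+2 <= bp t1 j.+1)%N by apply: bp_le => //; have := ltn_ord j; lia.
move=> h1 /(_ iD); lia.
Qed.

End TwoSegmentations.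

(** * Projected noise and missed change points *)

Section GivenNoise.
Context {R : realType} {H : lmodType R}.
Variable dot : {dot H for idfun}.
Context {n : nat}.
Variables (e : 'I_n -> H) (B : R).
Hypothesis B0 : 0 <= B.
Hypothesis noise_le : forall p q : 'I_n,
  dot (\sum_(i in ord_interval p q) e i) (\sum_(i in ord_interval p q) e i) <=
  #|ord_interval p q|%:R * B.

(** Each level set of c is an interval, to which the bound on the noise applies,
    and there are at most D of them. *)
Lemma ip_noise_projection_le (c : 'I_n -> nat) (D : nat) :
  (forall i j : 'I_n, (i <= j)%N -> (c i <= c j)%N) -> (forall i, (c i < D)%N) ->
  ip dot (block_mean c e) (block_mean c e) <= D%:R * B.
Proof.
move=> c_mono cD; rewrite (ip_block_mean_sum _ _ cD).
rewrite -[D in leRHS]subn0 -sumr_const_nat mulr_suml; apply: ler_sum => l _.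
rewrite mul1r; have [->|N0] := posnP (block_card c l).
  by rewrite invr0 mul0r.
rewrite mulrC ler_pdivrMr ?ltr0n// mulrC.
have [p [q pq]] := level_set_interval c_mono N0.
have := noise_le p q.
rewrite (_ : block_card c l = #|ord_interval p q|).
  by rewrite /block_sum (eq_bigl _ _ pq).
by apply: eq_card => i; rewrite inE.
Qed.

End GivenNoise.

Section TrueSegmentation.
Context {R : realType} {H : completeNormedModType R}.
Variable dot : {dot H for idfun}.
Hypothesis normE : forall f : H, `|f| ^+ 2 = dot f f.
Context {n : nat}.
Variables (mu : 'I_n -> H) (tstar : segmentation n).
Hypothesis htau : is_true_segmentation mu tstar.

Lemma true_segmentation_constant : constant_on_blocks (seg_label tstar) mu.
Proof.
move=> i j ij; apply: (htau.1 (seg_label tstar i)); rewrite ?in_segE ?seg_label_lt//.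
by rewrite ij.
Qed.

Lemma min_jump_ge0 : 0 <= min_jump mu.
Proof.
rewrite /min_jump; set S := [set r | _].
have [->|/set0P S0] := eqVneq S set0; first by rewrite inf0.
by apply: lb_le_inf => // _ [i [j [_ _ ->]]].
Qed.

Lemma min_jump_le (i j : 'I_n) : val j = (val i).+1 -> mu i <> mu j ->
  min_jump mu ^+ 2 <= dot (mu i - mu j) (mu i - mu j).
Proof.
move=> ij mij; rewrite -normE ler_pXn2r ?nnegrE ?min_jump_ge0//.
apply: ge_inf; last by exists i, j.
by exists 0 => _ [? [? [_ _ ->]]].
Qed.

Let L : nat := (\big[minn/n]_(0 <= l < nbseg tstar) seglen tstar l)%N.

Lemma min_seglen_le l : (l < nbseg tstar)%N -> (L <= seglen tstar l)%N.
Proof. by move=> lD; apply: bigmin_le. Qed.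

(** Around a breakpoint of tstar that t misses by dl, the block mean of t takes
    a single value while mu takes two values, on dl indices each. *)
Lemma missed_breakpoint_residual (t : segmentation n) (i dl : nat) :
  (1 <= i < nbseg tstar)%N -> (dl <= L)%N ->
  (forall j, (1 <= j < nbseg t)%N ->
     (dl <= `|(bp tstar i)%:Z - (bp t j)%:Z|)%N) ->
  dl%:R * min_jump mu ^+ 2 <=
  2 * ip dot (block_residual (seg_label t) mu) (block_residual (seg_label t) mu).
Proof.
move=> /andP[i1 iD] dlL hdl.
set a := block_residual (seg_label t) mu.
have [->|dl0] := posnP dl; first by rewrite mul0r mulr_ge0// ip_ge0.
set T := bp tstar i; have iE : i = i.-1.+1 by rewrite prednK.
have Tlo : (bp tstar i.-1 + dl <= T)%N.
  have := min_seglen_le (leq_ltn_trans (leq_pred i) iD).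
  rewrite /seglen -iE -/T => h.
  by have := bp_lt (t := tstar) (l := i.-1) (m := i); rewrite -/T; lia.
have Thi : (T + dl <= bp tstar i.+1)%N.
  have := min_seglen_le iD; rewrite /seglen -/T => h.
  by have := bp_lt (t := tstar) (ltnSn i) iD; rewrite -/T; lia.
have Tn : (T + dl <= n)%N by apply: leq_trans Thi _; exact: bp_le_n.
have o1 : (T.-1 < n)%N by lia.
have o2 : (T < n)%N by lia.
pose i1' := Ordinal o1; pose i2' := Ordinal o2.
have lab (x y : 'I_n) : (T - dl <= x < T + dl)%N -> (T - dl <= y < T + dl)%N ->
    seg_label t x = seg_label t y.
  wlog xy : x y / (x <= y)%N => [wl hx hy|].
    by have [xy|/ltnW yx] := leqP x y; [exact: wl|rewrite (wl y x)].
  move=> /andP[x1 x2] /andP[y1 y2]; apply: seg_label_const => // j /hdl.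
  rewrite -/T; lia.
have mu1 (x : 'I_n) : (T - dl <= x < T)%N -> mu x = mu i1'.
  move=> /andP[x1 x2]; apply: (htau.1 i.-1).
  - by lia.
  - by rewrite /in_seg -iE -/T x2 andbT; lia.
  - by rewrite /in_seg -iE -/T /=; lia.
have mu2 (x : 'I_n) : (T <= x < T + dl)%N -> mu x = mu i2'.
  move=> /andP[x1 x2]; apply: (htau.1 i) => //.
  - by rewrite /in_seg -/T x1 /=; lia.
  - by rewrite /in_seg -/T leqnn /=; lia.
have mu12 : mu i1' <> mu i2'.
  apply: (htau.2 i.-1); rewrite -?iE//.
  - by rewrite /in_seg -iE -/T /=; lia.
  - by rewrite /in_seg -/T leqnn /=; lia.
have jump : min_jump mu ^+ 2 <= dot (mu i1' - mu i2') (mu i1' - mu i2').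
  by apply: min_jump_le => //=; rewrite prednK//; lia.
pose g := block_mean (seg_label t) mu i2'.
have gE (x : 'I_n) : (T - dl <= x < T + dl)%N -> block_mean (seg_label t) mu x = g.
  move=> hx; rewrite /g /block_mean (lab x i2')//=; lia.
have par := dot_le_parallelogram dot (mu i1') (mu i2') g.
have s1 : \sum_(x : 'I_n | (T - dl <= x < T)%N) dot (a x) (a x) =
    dl%:R * dot (mu i1' - g) (mu i1' - g).
  rewrite (eq_bigr (fun=> dot (mu i1' - g) (mu i1' - g))) => [|x hx].
    rewrite sumr_const -[LHS]mulr_natl (card_ord_range (T - dl)) ?(ltnW o2)//.
    by congr (_%:R * _); lia.
  by rewrite /a /block_residual mu1// gE//; lia.
have s2 : \sum_(x : 'I_n | (T <= x < T + dl)%N) dot (a x) (a x) =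
    dl%:R * dot (mu i2' - g) (mu i2' - g).
  rewrite (eq_bigr (fun=> dot (mu i2' - g) (mu i2' - g))) => [|x hx].
    rewrite sumr_const -[LHS]mulr_natl (card_ord_range T)//.
    by congr (_%:R * _); lia.
  by rewrite /a /block_residual mu2// gE//; lia.
have split_le : \sum_(x : 'I_n | (T - dl <= x < T)%N) dot (a x) (a x) +
    \sum_(x : 'I_n | (T <= x < T + dl)%N) dot (a x) (a x) <= ip dot a a.
  rewrite /ip [leRHS](bigID (fun x : 'I_n => (T - dl <= x < T)%N))/= lerD2l.
  rewrite [leRHS](bigID (fun x : 'I_n => (T <= x < T + dl)%N))/=.
  rewrite -[leLHS]addr0 lerD//; last by apply: sumr_ge0 => x _; exact: dotvv_ge0.
  rewrite le_eqVlt; apply/orP; left; apply/eqP; apply: eq_bigl => x; lia.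
have dlR : 0 <= dl%:R :> R by [].
have h1 := ler_wpM2l dlR (le_trans jump par).
apply: (le_trans h1); rewrite mulrCA ler_pM2l//.
by apply: le_trans split_le; rewrite s1 s2 mulrDr.
Qed.

End TrueSegmentation.

(** * Detection by penalized risk *)

Section Numerics.
Context {R : realType}.

(** The ratio of D' + D - 1 to D' - D is largest for D' = D + 1, where it is
    2 D, and 16 D < (74 / 3) (D + 1). *)
Lemma overestimation_numerics (D D' C x : R) : 0 < x -> 1 <= D -> D + 1 <= D' ->
  74 / 3 * (D + 1) * x < C -> C * (D' - D) <= (D' + D - 1) * (8 * x) -> False.
Proof.
move=> x0 D1 DD' hC h.
have z1 : 1 <= D' - D by lra.
have h1 : D' + D - 1 <= 2 * D * (D' - D) by nra.
have h2 : (D' + D - 1) * (8 * x) <= 2 * D * (D' - D) * (8 * x).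
  by rewrite ler_pM2r// mulr_gt0.
have h3 : C * (D' - D) <= 16 * D * x * (D' - D) by lra.
have h4 : C <= 16 * D * x by move: h3; rewrite ler_pM2r//; lra.
have : D * x >= 0 by rewrite mulr_ge0//; lra.
lra.
Qed.

(** The upper bound on C gives (3 / 4) A > (9 / 8) C M^2 D, whence the weight
    D / 8. The worst case is D' = 1, for which the comparison is a quadratic
    inequality in D. *)
Lemma underestimation_numerics (D D' C x : R) : 0 < x -> 2 <= D -> 1 <= D' ->
  74 / 3 * (D + 1) * x < C ->
  C * (D / 8 + D') < 32 * (D' + D - 1) * x -> False.
Proof.
move=> x0 D2 D'1 hC h.
have pos : 0 < D / 8 + D' by lra.
have poly : 96 * (D' + D - 1) <= 74 * (D + 1) * (D / 8 + D') by nra.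
have h1 : 96 * (D' + D - 1) * x <= 74 * (D + 1) * (D / 8 + D') * x.
  by rewrite ler_pM2r.
have h2 : 74 / 3 * (D + 1) * x * (D / 8 + D') < C * (D / 8 + D').
  by rewrite ltr_pM2r.
lra.
Qed.

End Numerics.

Section Detection.
Context {R : realType} {H : completeNormedModType R}.
Variable dot : {dot H for idfun}.
Hypothesis normE : forall f : H, `|f| ^+ 2 = dot f f.
Context {n : nat}.
Variables (mu e : 'I_n -> H) (M x C : R).
Hypotheses (n0 : (0 < n)%N) (M0 : 0 < M) (x0 : 0 < x).
Hypothesis noise_le : forall p q : 'I_n,
  dot (\sum_(i in ord_interval p q) e i) (\sum_(i in ord_interval p q) e i) <=
  #|ord_interval p q|%:R * (8 * M ^+ 2 * x).
Variables (tstar that : segmentation n).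
Hypothesis htau : is_true_segmentation mu tstar.
Hypothesis hD : (2 <= nbseg tstar)%N.
Let Y i := mu i + e i.
Let Q (t : segmentation n) :=
  ip dot (block_mean (seg_label t) Y) (block_mean (seg_label t) Y).
Hypothesis hmin : Q tstar + C * M ^+ 2 * ((nbseg that)%:R - (nbseg tstar)%:R) <= Q that.
Hypothesis hC1 : 74 / 3 * ((nbseg tstar)%:R + 1) * x < C.
Hypothesis hC2 : C < min_jump mu ^+ 2 / M ^+ 2 *
  (min_rel_seglen tstar / (6 * (nbseg tstar)%:R)) * n%:R.

Let D : R := (nbseg tstar)%:R.
Let D' : R := (nbseg that)%:R.
Let L : nat := (\big[minn/n]_(0 <= l < nbseg tstar) seglen tstar l)%N.
Let a := block_residual (seg_label that) mu.
Let A := ip dot a a.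

Let M20 : 0 < M ^+ 2.
Proof. by rewrite exprn_gt0. Qed.

Let D2 : 2 <= D.
Proof. by rewrite /D ler_nat. Qed.

Let D'1 : 1 <= D'.
Proof. by rewrite /D' ler1n nbseg_gt0. Qed.

Let C0 : 0 < C.
Proof. by apply: lt_trans hC1; rewrite !mulr_gt0//; have := D2; rewrite /D; lra. Qed.

(** The upper bound on C, cleared of denominators. *)
Lemma signal_to_noise : 6 * D * (C * M ^+ 2) < min_jump mu ^+ 2 * L%:R.
Proof.
move: hC2; rewrite /min_rel_seglen -/L -/D => h.
have D0 : 0 < D by have := D2; lra.
have nR : 0 < n%:R :> R by rewrite ltr0n.
rewrite (_ : min_jump mu ^+ 2 / M ^+ 2 * _ * _ =
    min_jump mu ^+ 2 * L%:R / (6 * D * M ^+ 2)) in h; last first.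
  by field; rewrite !gt_eqF.
move: h; rewrite ltr_pdivlMr ?mulr_gt0// => h.
lra.
Qed.

Lemma detection_gap (th : R) : 0 < th -> th <= 1 ->
  (1 - th) * A + C * M ^+ 2 * (D' - D) <= (D' + D - 1) * (8 * M ^+ 2 * x) / th.
Proof.
move=> th0 th1; set s := common_label that tstar.
have B0 : 0 <= 8 * M ^+ 2 * x by rewrite !mulr_ge0// ltW.
have := block_mean_gap (dot := dot) (c := seg_label that)
  (cstar := seg_label tstar) (s := s) (m := mu) (e := e) (th := th)
  (gap := C * M ^+ 2 * (D' - D)).
move=> /(_ _ _ _ th0 th1 hmin) h; apply: le_trans (h _ _ _) _.
- by move=> i j /common_label_refines[].
- by move=> i j /common_label_refines[].
- exact: true_segmentation_constant.
rewrite ler_pM2r ?invr_gt0//.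
have -> : D' + D - 1 = ((nbseg that + nbseg tstar).-1)%:R.
  by rewrite -subn1 natrB ?natrD// addn_gt0 nbseg_gt0.
apply: (ip_noise_projection_le B0 noise_le).
  exact: common_label_mono.
exact: common_label_lt.
Qed.

(** The gap inequality at th = 1, where the residual disappears. *)
Lemma no_overestimation : (nbseg that <= nbseg tstar)%N.
Proof.
rewrite leqNgt; apply/negP => DD'.
have := detection_gap ltr01 (lexx 1); rewrite subrr mul0r add0r divr1 => h.
apply: (@overestimation_numerics _ D D' C x) => //; first by have := D2; lra.
  by rewrite /D /D' natr1 ler_nat.
rewrite -(ler_pM2r M20); lra.
Qed.

(** The gap inequality at th = 1/4, with a true breakpoint missed by half the
    shortest true segment. *)
Lemma no_underestimation : (nbseg tstar <= nbseg that)%N.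
Proof.
rewrite leqNgt; apply/negP => DD'.
have [i [iD far]] : exists i, (1 <= i < nbseg tstar)%N /\
    forall j, (1 <= j < nbseg that)%N ->
      (uphalf L <= `|(bp tstar i)%:Z - (bp that j)%:Z|)%N.
  apply: (@isolated_breakpoint _ _ _ L) => //; last by lia.
  by move=> l lD; exact: min_seglen_le.
have L2 : (L <= (uphalf L).*2)%N by lia.
have dlL : (uphalf L <= L)%N by lia.
have res := missed_breakpoint_residual normE htau iD dlL far.
rewrite -/a -/A in res.
have L2R : L%:R <= 2 * (uphalf L)%:R :> R by rewrite -natrM ler_nat mul2n.
have J0 : 0 <= min_jump mu ^+ 2 by exact: sqr_ge0.
have h1 : min_jump mu ^+ 2 * L%:R <= min_jump mu ^+ 2 * (2 * (uphalf L)%:R).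
  exact: ler_wpM2l.
have snr := signal_to_noise.
have th0 : 0 < 4^-1 :> R by rewrite invr_gt0.
have th1 : 4^-1 <= 1 :> R by lra.
have gap := detection_gap th0 th1.
rewrite invrK in gap.
apply: (@underestimation_numerics _ D D' C x) => //.
rewrite -(ltr_pM2r M20); lra.
Qed.

(** Localization is the gap inequality at th = 1/2. *)
Lemma breakpoint_detection : nbseg that = nbseg tstar /\
  n%:R^-1 * (d_infty1 tstar that)%:R <=
    148 * (nbseg tstar)%:R * M ^+ 2 / min_jump mu ^+ 2 * (x / n%:R).
Proof.
have DD' : nbseg that = nbseg tstar.
  by apply/eqP; rewrite eqn_leq no_overestimation no_underestimation.
split=> //; rewrite -/D.
have D'D : D' = D by rewrite /D' DD'.
have D0 : 0 < D by have := D2; lra.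
have snr := signal_to_noise.
have CM0 : 0 < 6 * D * (C * M ^+ 2) by rewrite !mulr_gt0.
have J0 : 0 < min_jump mu ^+ 2.
  rewrite lt0r sqr_ge0 andbT; apply/eqP => J.
  by have := lt_trans CM0 snr; rewrite J mul0r ltxx.
have nR : 0 < n%:R :> R by rewrite ltr0n.
rewrite [leRHS](_ : _ = n%:R^-1 * (148 * D * M ^+ 2 * x / min_jump mu ^+ 2)); last first.
  have J1 : min_jump mu != 0 by move: J0; rewrite exprn_even_gt0.
  by field; rewrite J1 gt_eqF.
rewrite ler_pM2l ?invr_gt0//.
have DMx : 0 < D * M ^+ 2 * x by rewrite !mulr_gt0.
have th0 : 0 < 2^-1 :> R by rewrite invr_gt0.
have th1 : 2^-1 <= 1 :> R by lra.
have gap := detection_gap th0 th1.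
rewrite invrK D'D subrr mulr0 addr0 in gap.
have gap' : 2 * A <= 128 * (D * M ^+ 2 * x).
  have : 0 < M ^+ 2 * x by rewrite mulr_gt0.
  lra.
rewrite /d_infty1 big_nat; elim/big_ind : _ => [|u v hu hv|i iD].
- by rewrite divr_ge0 ?(ltW J0)//; lra.
- by rewrite /maxn; case: ifP.
set dl := (\big[minn/n]_(1 <= j < nbseg that) _)%N.
(* The distance is capped at L, beyond which neighbouring true breakpoints
   interfere; the cap turns out not to be reached. *)
have near : forall j, (1 <= j < nbseg that)%N ->
    (minn dl L <= `|(bp tstar i)%:Z - (bp that j)%:Z|)%N.
  by move=> j jD; rewrite geq_min (bigmin_le _ _ jD).
have res := missed_breakpoint_residual normE htau iD (geq_minr dl L) near.
rewrite -/a -/A in res.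
have CD : 74 / 3 * (D + 1) * x * M ^+ 2 < C * M ^+ 2 by rewrite ltr_pM2r.
have dlL : (dl < L)%N.
  rewrite ltnNge; apply/negP => Ldl; move: res; rewrite (minn_idPr Ldl) => res.
  have : 128 * (D * M ^+ 2 * x) <= 6 * D * (74 / 3 * (D + 1) * x * M ^+ 2).
    have : 0 <= D * (D * M ^+ 2 * x) by rewrite mulr_ge0// ltW.
    lra.
  have : 6 * D * (74 / 3 * (D + 1) * x * M ^+ 2) < 6 * D * (C * M ^+ 2).
    by rewrite ltr_pM2l// mulr_gt0.
  lra.
move: res; rewrite (minn_idPl (ltnW dlL)) => res.
rewrite ler_pdivlMr//; lra.
Qed.

End Detection.

(** Expanding |Y - Pi_t Y|^2 = |Y|^2 - |Pi_t Y|^2 in the kernel. *)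
Lemma penalized_riskE (R : realType) (n : nat) (E : Type) (k : E -> E -> R)
  (hk : psd_kernel k) (H : completeNormedModType R) (dot : {dot H for idfun})
  (ev : H -> E -> R) (Phi : E -> H) (hH : is_rkhs k dot ev Phi)
  (z : 'I_n -> E) (M C : R) (t : segmentation n) :
  let p := block_mean (seg_label t) (fun i => Phi (z i)) in
  penalized_risk k z M C t =
  n%:R^-1 * (\sum_i k (z i) (z i) - ip dot p p + C * M ^+ 2 * (nbseg t)%:R).
Proof.
rewrite /= /penalized_risk /empirical_risk (ip_block_mean_sum _ _ (seg_label_lt t)).
rewrite [RHS]mulrDr mulrBr; congr (_ - _ * _ + _); last by rewrite mulrC.
apply: eq_big_nat => l /andP[_ lD].
rewrite block_card_seg// dot_suml (eq_bigl _ _ (fun i => in_segE i lD)).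
congr (_ * _); apply: eq_bigr => i _; rewrite dot_sumr.
rewrite (eq_bigl _ _ (fun i => in_segE i lD)).
by apply: eq_bigr => j _; rewrite (dot_feature hk hH).
Qed.

Theorem theorem3p1 (R : realType) (n : nat) (hn : (2 <= n)%N)
  (d : measure_display) (T : measurableType d) (P : probability T R)
  (d' : measure_display) (E : measurableType d')
  (X : 'I_n -> {RV P >-> E}) (hX : mutually_independent X)
  (k : E -> E -> R) (hk : psd_kernel k)
  (hkm : measurable_fun [set: E * E] (fun p : E * E => k p.1 p.2))
  (H : completeNormedModType R) (dot : {dot H for idfun})
  (ev : H -> E -> R) (Phi : E -> H)
  (hH : is_rkhs k dot ev Phi) (hsep : separable H)
  (mu : 'I_n -> H)
  (hmu : forall i, mu i = bochner_expectation P (fun w => Phi (X i w)))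
  (taustar : segmentation n) (htau : is_true_segmentation mu taustar)
  (M : R) (hM : 0 < M)
  (hkM : forall i, {ae P, forall w, k (X i w) (X i w) <= M ^+ 2})
  (hD : (2 <= nbseg taustar)%N) (y : R) (hy : 0 < y) :
  exists Omega : set T,
    [/\ measurable Omega,
        ((1 - expR (- y))%:E <= P Omega)%E &
        forall w : T, Omega w ->
        forall (C : R) (tauhat : segmentation n), 0 < C ->
          (forall t : segmentation n,
             penalized_risk k (fun i => X i w) M C tauhat <=
             penalized_risk k (fun i => X i w) M C t) ->
          74 / 3 * ((nbseg taustar)%:R + 1) * (y + ln n%:R + 1) < C ->
          C < min_jump mu ^+ 2 / M ^+ 2 *
              (min_rel_seglen taustar / (6 * (nbseg taustar)%:R)) * n%:R ->
          nbseg tauhat = nbseg taustar /\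
          n%:R^-1 * (d_infty1 taustar tauhat)%:R <=
            148 * (nbseg taustar)%:R * M ^+ 2 / min_jump mu ^+ 2 *
            ((y + ln n%:R + 1) / n%:R)].
Proof.
have n0 : (0 < n)%N by exact: ltnW.
have muE : mu = fun i => bochner_expectation P (fun w => Phi (X i w)).
  by apply/funext.
have [G [mG PG noise_le]] :=
  uniform_noise_bound hX hk hkm hH hsep hM hkM n0 hy.
exists G; split => // w Gw C tauhat _ hmin hC1 hC2.
pose e i := Phi (X i w) - mu i.
have x0 : 0 < y + ln n%:R + 1.
  have : 0 <= ln n%:R :> R by rewrite ln_ge0// ler1n.
  lra.
apply: (@breakpoint_detection _ _ dot (rkhs_norm hH) _ mu e M (y + ln n%:R + 1) C) => //.
  by move=> p q; rewrite /e muE; exact: noise_le.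
have YE : (fun i => mu i + e i) = fun i => Phi (X i w).
  by apply/funext => i; rewrite /e addrC subrK.
have := hmin taustar; rewrite !(penalized_riskE hk hH) YE.
by rewrite ler_pM2l ?invr_gt0 ?ltr0n//; lra.
Qed.
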